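(* Let $\Psi$ be a marked point process on $\mathbb R^2\times[0,\pi)$ whose ground process $\Phi$ is simple and for which there are a finite constant $c>0$ and a probability measure $\mathbb Q$ on $[0,\pi)$ such that for each $n\in\mathbb N$ the $n$th factorial moment measure $\alpha^{(n)}$ of $\Psi$ satisfies $$\alpha^{(n)}\big(d(P_1,\theta_1),\ldots,d(P_n,\theta_n)\big)\le c^n\,dP_1\cdots dP_n\,\mathbb Q(d\theta_1)\cdots\mathbb Q(d\theta_n).$$ Then, for each $k\in\{1,2\}$, almost surely there exists a unique growth-maximal hard-segment model (GMHS model) of Type $k$ based on $\Psi$.
   Context: A marked point process $\Psi$ is a random element of the space $\mathbf N$ of countable sets $\mathbf P_\Theta\subset\mathbb R^2\times[0,\pi)$ with $\mathrm{card}(\mathbf P_\Theta\cap(B\times[0,\pi)))<\infty$ for all bounded $B\subset\mathbb R^2$, equipped with the smallest $\sigma$-field making the counting maps $\mathbf P_\Theta\mapsto\mathrm{card}(\mathbf P_\Theta\cap C)$ measurable for all measurable $C$. The ground process $\Phi$ is the projection of $\Psi$ to $\mathbb R^2$. $dP$ denotes Lebesgue measure on $\mathbb R^2$. The factorial moment measure is $\alpha^{(n)}(C)=\mathbb E\sum^{\neq}\mathbf 1\{(x_1,\dots,x_n)\in C\}$, summing over $n$-tuples of distinct elements of $\Psi$. For a realization write its elements as $P_i^\theta=(P_i,\theta_i)$. Put $u(\theta)=(\cos\theta,\sin\theta)$. For $i\ne j$: if $\theta_i\neq\theta_j$, $P_{ij}$ is the intersection point of the two infinite lines through $P_i$, $P_j$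 with directions $\theta_i$, $\theta_j$, and $d_{ij}:=|P_i-P_{ij}|$, $d_{ji}:=|P_j-P_{ij}|$. If $\theta_i=\theta_j$, then $d_{ij}=d_{ji}:=\tfrac12|P_i-P_j|$ if $P_j$ lies on the infinite line through $P_i$ with direction $\theta_i$, and $d_{ij}=d_{ji}:=\infty$ otherwise. Given $R_i\in[0,\infty]$ for each $i$, let $S_i:=\{P_i+tu(\theta_i): |t|\le R_i\}$ if $R_i<\infty$ and $S_i:=\{P_i+tu(\theta_i):t\in\mathbb R\}$ if $R_i=\infty$. The relative interior of $S_i$ is $\{P_i+tR_iu(\theta_i):-1<t<1\}$ if $R_i<\infty$, and $S_i$ itself if $R_i=\infty$. The set $\{(P_i^\theta,R_i)\}$ is a hard-segment model (HS model) if for all $i\ne j$ the segments $S_i,S_j$ have disjoint relative interiors. In an HS model, distinct $P_i^\theta,P_j^\theta$ are segment neighbours if $S_i\cap S_j\ne\emptyset$. A segment neighbour $P_j^\theta$ of $P_i^\theta$ is a Type 1 stopping segment neighbour of $P_i^\theta$ if $R_i=d_{ij}$, $d_{ij}>d_{ji}$ and $R_j>d_{ji}$; it is a Type 2 stopping segment neighbour of $P_i^\theta$ if $R_i=\max\{d_{ij},d_{ji}\}$ and $d_{ji}\le R_j\le R_i$. For $k=1,2$, an HS model is growth-maximal of Type $k$ (a GMHS model of Type $k$) if every $P_i^\theta$ with $R_i<\infty$ has a Type $k$ stopping segment neighbour. *)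

(* Defs.v *)
From HB Require Import structures.
From mathcomp Require Import all_boot all_order all_algebra.
From mathcomp Require Import all_classical all_reals all_analysis.
From mathcomp Require Import measurable_realfun.

Set Implicit Arguments.
Unset Strict Implicit.
Unset Printing Implicit Defensive.
Import Order.TTheory GRing.Theory Num.Theory.
Import numFieldNormedType.Exports.
Local Open Scope classical_set_scope.
Local Open Scope ring_scope.

(* [measurableTypeR R] is R with the sigma-algebra carrying [lebesgue_measure];
   it is convertible to R. *)
Notation plane R := (measurableTypeR R * measurableTypeR R)%type.

(* A pair (P, theta).  The type lets theta range over R; that theta lies in
   [0, pi) is imposed on configurations and on the law of the marks.  The
   measurable subsets of R^2 x [0, pi) are the traces of the measurable sets of
   this type. *)
Notation mpoint R := (plane R * measurableTypeR R)%type.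

Section point_processes.
Context (R : realType).

(* [bounded_set] uses the max norm of R * R, which has the same bounded sets as
   the Euclidean norm. *)
Record config := Config {
  points :> set (mpoint R);
  config_marks : points `<=` [set p | p.2 \in `[0, pi[];
  config_countable : countable points;
  config_locally_finite : forall B : set (R * R),
    bounded_set B -> finite_set (points `&` [set p | B p.1]) }.

Lemma empty_config_marks :
  (set0 : set (mpoint R)) `<=` [set p | p.2 \in `[0, pi[].
Proof. exact: sub0set. Qed.

Lemma empty_config_locally_finite (B : set (R * R)) :
  bounded_set B -> finite_set ((set0 : set (mpoint R)) `&` [set p | B p.1]).
Proof. by rewrite set0I. Qed.

HB.instance Definition _ := gen_eqMixin config.
HB.instance Definition _ := gen_choiceMixin config.
HB.instance Definition _ := isPointed.Build config
  (Config empty_config_marks (countable0 _) empty_config_locally_finite).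

Definition card_in (C : set (mpoint R)) (X : config) : \bar R :=
  counting (X `&` C).

Definition count_events : set (set config) :=
  [set E | exists2 C : set (mpoint R), measurable C &
           exists2 B : set (\bar R), measurable B & E = card_in C @^-1` B].

Definition config_space := g_sigma_algebraType count_events.

(* The projection to R^2 is counted with multiplicity: elements with different
   marks may share a location. *)
Definition ground (X : config) (B : set (R * R)) : \bar R :=
  card_in [set p | B p.1] X.

Definition simple_ground (X : config) : Prop :=
  forall x : R * R, (ground X [set x] <= 1)%E.

Definition distinct_tuples (X : config) (n : nat) :
    set (n.-tuple (mpoint R)) :=
  [set t : n.-tuple (mpoint R) | uniq t /\ forall i, points X (tnth t i)].

Definition factorial_moment d (W : measurableType d) (P : probability W R)
    (Psi : W -> config) (n : nat) (C : set (n.-tuple (mpoint R))) : \bar R :=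
  (\int[P]_w \esum_(t in @distinct_tuples (Psi w) n) (\1_C t)%:E)%E.

(* dP Q(dtheta) *)
Definition location_mark_measure (Q : probability (measurableTypeR R) R) :
    set (mpoint R) -> \bar R :=
  ((@lebesgue_measure R \x @lebesgue_measure R) \x Q)%E.
End point_processes.

(* n-fold product of a sigma-finite measure, as an iterated integral. *)
Fixpoint power_measure (R : realType) d (T : measurableType d)
    (mu : set T -> \bar R) (n : nat) : set (n.-tuple T) -> \bar R :=
  match n with
  | 0 => fun C => \d_([tuple] : 0.-tuple T) C
  | m.+1 => fun C =>
      (\int[mu]_x power_measure mu [set t : m.-tuple T | C [tuple of x :: t]])%E
  end.

Section hard_segments.
Context (R : realType).
Implicit Types (p q : mpoint R) (X : config R) (rad : mpoint R -> \bar R).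

Definition eucl_dist (x y : R * R) : R :=
  Num.sqrt ((x.1 - y.1) ^+ 2 + (x.2 - y.2) ^+ 2).

Definition on_line (p : R * R * R) (t : R) : R * R :=
  (p.1.1 + t * cos p.2, p.1.2 + t * sin p.2).

Definition line p : set (R * R) := [set on_line p t | t in setT].

(* For different marks in [0, pi) the intersection is a singleton, and [get]
   returns its element. *)
Definition crossing p q : R * R := get (line p `&` line q).

(* d_ij, with p = P_i^theta and q = P_j^theta. *)
Definition cross_dist p q : \bar R :=
  if p.2 == q.2 then
    if q.1 \in line p then (2^-1 * eucl_dist p.1 q.1)%:E else +oo%E
  else (eucl_dist p.1 (crossing p q))%:E.

(* Radii are assumed nonnegative in [hs_model], so -oo does not occur below. *)
Definition segment p (r : \bar R) : set (R * R) :=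
  if r is s%:E then [set on_line p t | t in [set t | `|t| <= s]] else line p.

Definition rel_interior p (r : \bar R) : set (R * R) :=
  if r is s%:E then [set on_line p (t * s) | t in [set t | -1 < t < 1]]
  else line p.

(* Only the values of [rad] on X are relevant. *)
Definition hs_model X rad : Prop :=
  (forall p, points X p -> (0 <= rad p)%E) /\
  (forall p q, points X p -> points X q -> p <> q ->
     rel_interior p (rad p) `&` rel_interior q (rad q) = set0).

Definition segment_neighbour X rad p q : Prop :=
  [/\ points X p, points X q, p <> q & segment p (rad p) `&` segment q (rad q) !=set0].

Inductive growth_type := Type1 | Type2.

(* q is a stopping segment neighbour of p. *)
Definition stopping_neighbour (k : growth_type) X rad p q : Prop :=
  segment_neighbour X rad p q /\
  match k with
  | Type1 => [/\ rad p = cross_dist p q,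
                 (cross_dist q p < cross_dist p q)%E
               & (cross_dist q p < rad q)%E]
  | Type2 => rad p = maxe (cross_dist p q) (cross_dist q p) /\
             (cross_dist q p <= rad q <= rad p)%E
  end.

Definition gmhs_model (k : growth_type) X rad : Prop :=
  hs_model X rad /\
  forall p, points X p -> (rad p < +oo)%E ->
    exists q, stopping_neighbour k X rad p q.

(* A model is the family of radii of the elements of X, so uniqueness is
   agreement on X. *)
Definition exists_unique_gmhs_model (k : growth_type) X : Prop :=
  exists2 rad, gmhs_model k X rad &
    forall rad', gmhs_model k X rad' -> forall p, points X p -> rad' p = rad p.

End hard_segments.

(* Main.v *)
(** Write d(p,q) for [cross_dist p q] and e(p,q) = max (d(p,q), d(q,p)).
    Almost surely there is no finite tie d(p,q) = d(q,p), d(p,q) = d(p,r) or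
    d(p,q) = d(r,p), since each of them confines one location to a line.
    Without ties, a GMHS model is the same thing as a solution of
      R(p) = inf {e(p,q) : q <> p, d(q,p) <= R(q)},
    where for Type 1 only the q with d(q,p) < d(p,q) are allowed.  Whether
    R(p) >= s is decided by whether R(q) >= d(q,p) for the q with e(p,q) < s,
    so there is exactly one solution if there is no infinite chain
      s > e(p0,p1) >= d(p1,p0) > e(p1,p2) >= d(p2,p1) > ...
    Along such a chain the decreasing numbers d(p_(n+1),p_n) end up in an
    interval of arbitrarily small length h, with all e(p_n,p_(n+1)) below some
    T.  Given p, the points q with d(q,p) in the interval and e(p,q) <= T lie in
    two strips of total area at most 16 T h, so the expected number of simple
    paths with n such steps from a bounded set is O((16 c T h)^n), which tends
    to 0 when h is small. *)

Require Import Defs.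
From HB Require Import structures.
From mathcomp Require Import all_boot all_order all_algebra.
From mathcomp Require Import all_classical all_reals all_analysis.
From mathcomp Require Import measurable_realfun.
From mathcomp Require Import ring lra.
Import Order.TTheory GRing.Theory Num.Theory.
Import numFieldNormedType.Exports.
Local Open Scope classical_set_scope.
Local Open Scope ring_scope.

(** * Crossing points of two lines and the distances to them *)

Section crossing_lines.
Context (R : realType).
Implicit Types (p q r : mpoint R) (s t th : R).

(* The cross product of the vector from p to q with the direction th. *)
Definition wedge p q th : R :=
  (q.1.1 - p.1.1) * sin th - (q.1.2 - p.1.2) * cos th.

Lemma wedgeC p q th : wedge q p th = - wedge p q th.
Proof. by rewrite /wedge; ring. Qed.

Lemma sin_sub_neq0 s t : s \in `[0, pi[ -> t \in `[0, pi[ -> s != t ->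
  sin (t - s) != 0.
Proof.
move=> hs ht; have /andP[s0 sp] : 0 <= s < pi by [].
have /andP[t0 tp] : 0 <= t < pi by [].
rewrite neq_lt => /orP[st|ts].
  by rewrite gt_eqF// sin_gt0_pi//; apply/andP; split; lra.
rewrite -opprB sinN oppr_eq0 gt_eqF// sin_gt0_pi//.
by apply/andP; split; lra.
Qed.

(** Cramer's rule for [t u(p.2) - s u(q.2) = q.1 - p.1], where [u] is the unit direction. Without
    division it also covers parallel lines. *)
Lemma on_line_meet p q t s : on_line p t = on_line q s ->
  t * sin (q.2 - p.2) = wedge p q q.2 /\ s * sin (q.2 - p.2) = wedge p q p.2.
Proof.
case=> e1 e2; rewrite sinB /wedge.
have -> : q.1.1 = p.1.1 + t * cos p.2 - s * cos q.2.
  by apply/esym/eqP; rewrite subr_eq; apply/eqP.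
have -> : q.1.2 = p.1.2 + t * sin p.2 - s * sin q.2.
  by apply/esym/eqP; rewrite subr_eq; apply/eqP.
by split; ring.
Qed.

Lemma on_line_wedge p q : sin (q.2 - p.2) != 0 ->
  on_line p (wedge p q q.2 / sin (q.2 - p.2)) =
  on_line q (wedge p q p.2 / sin (q.2 - p.2)).
Proof.
move=> h; rewrite /on_line /wedge; rewrite sinB in h *.
by congr pair; field.
Qed.

Lemma eucl_distC (x y : R * R) : eucl_dist x y = eucl_dist y x.
Proof. by rewrite /eucl_dist; congr Num.sqrt; ring. Qed.

Lemma eucl_dist_on_line p t : eucl_dist p.1 (on_line p t) = `|t|.
Proof.
rewrite /eucl_dist /on_line /= -sqrtr_sqr; congr Num.sqrt.
have := cos2Dsin2 (p.2 : R); set c := cos _; set d := sin _ => e.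
have -> : (p.1.1 - (p.1.1 + t * c)) ^+ 2 + (p.1.2 - (p.1.2 + t * d)) ^+ 2 =
  t ^+ 2 * (c ^+ 2 + d ^+ 2) by ring.
by rewrite e mulr1.
Qed.

Lemma cross_distE p q : p.2 \in `[0, pi[ -> q.2 \in `[0, pi[ -> p.2 != q.2 ->
  cross_dist p q = (`|wedge p q q.2| / `|sin (q.2 - p.2)|)%:E.
Proof.
move=> hp hq npq; have h := sin_sub_neq0 _ _ hp hq npq.
rewrite /cross_dist (negbTE npq); congr EFin.
have : (line p `&` line q) (crossing p q).
  apply: (@getI _ _ (on_line p (wedge p q q.2 / sin (q.2 - p.2)))).
  split; first by eexists.
  by rewrite on_line_wedge//; eexists.
move=> [[t _ <-] [s _ e]].
have [et _] := on_line_meet _ _ _ _ (esym e).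
by rewrite eucl_dist_on_line -et normrM mulfK// normr_eq0.
Qed.

Lemma cross_dist_ge0 p q : (0 <= cross_dist p q)%E.
Proof.
rewrite /cross_dist; case: ifP => _; last by rewrite lee_fin sqrtr_ge0.
by case: ifP => _ //; rewrite lee_fin mulr_ge0// ?invr_ge0// sqrtr_ge0.
Qed.

(** For equal marks the two distances always agree, so the condition says that neither location lies
    on the line of the other. For different marks both are finite, so it says that they differ. *)
Definition tie_free p q := cross_dist p q = cross_dist q p -> cross_dist p q = +oo%E.

Lemma parallel_cross_distC p q : p.2 = q.2 -> cross_dist p q = cross_dist q p.
Proof.
move=> e; rewrite /cross_dist e eqxx eucl_distC.
suff -> : (q.1 \in line p) = (p.1 \in line q) by [].
have H (a b : mpoint R) : a.2 = b.2 -> b.1 \in line a -> a.1 \in line b.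
  case: a b => [[a1 a2] ath] [[b1 b2] bth] /= ->; rewrite !inE.
  case=> t _ [<- <-]; exists (- t) => //; rewrite /on_line /=.
  by congr pair; ring.
by apply/idP/idP; apply: H.
Qed.

(** Without ties parallel lines never meet, so a common point is the crossing point and its
    parameters are the signed distances. *)
Lemma meet_cross_dist p q t s :
  p.2 \in `[0, pi[ -> q.2 \in `[0, pi[ -> tie_free p q ->
  on_line p t = on_line q s ->
  cross_dist p q = `|t|%:E /\ cross_dist q p = `|s|%:E.
Proof.
move=> hp hq nt e.
have [epq|npq] := eqVneq p.2 q.2.
  have := nt (parallel_cross_distC p q epq).
  rewrite /cross_dist epq eqxx.
  case: ifPn => // /negP[]; rewrite inE; exists (t - s) => //.
  case: p q e epq {hp hq nt} => [[p1 p2] pth] [[q1 q2] qth] /= + epq.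
  by rewrite epq /on_line /= => -[e1 e2]; congr pair; lra.
have h := sin_sub_neq0 _ _ hp hq npq.
have [et es] := on_line_meet _ _ _ _ e.
split; rewrite cross_distE//; last by rewrite eq_sym.
  by rewrite -et normrM mulfK// normr_eq0.
by rewrite wedgeC normrN -opprB sinN normrN -es normrM mulfK// normr_eq0.
Qed.

Lemma cross_dist_meet p q :
  p.2 \in `[0, pi[ -> q.2 \in `[0, pi[ -> tie_free p q ->
  (cross_dist p q < +oo)%E -> exists t s, on_line p t = on_line q s.
Proof.
move=> hp hq nt fin.
have [epq|npq] := eqVneq p.2 q.2.
  by move: fin; rewrite (nt (parallel_cross_distC p q epq)) ltxx.
by eexists; eexists; apply: on_line_wedge; exact: sin_sub_neq0.
Qed.

(** Triangle inequality through the common point, in each coordinate. *)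
Lemma meet_dist_bound p q t s : on_line p t = on_line q s ->
  `|q.1.1 - p.1.1| <= `|t| + `|s| /\ `|q.1.2 - p.1.2| <= `|t| + `|s|.
Proof.
have H (a b c d : R) : c = a - b -> `|a| <= `|t| -> `|b| <= d -> `|c| <= `|t| + d.
  by move=> -> ha hb; rewrite (le_trans (ler_normB _ _))// lerD.
have M (a b : R) : `|b| <= 1 -> `|a * b| <= `|a|.
  by move=> hb; rewrite normrM ler_piMr.
case=> e1 e2; split.
  apply: (H (t * cos p.2) (s * cos q.2)).
  - by lra.
  - by apply: M; rewrite cos_max.
  - by apply: M; rewrite cos_max.
apply: (H (t * sin p.2) (s * sin q.2)).
- by lra.
- by apply: M; rewrite sin_max.
- by apply: M; rewrite sin_max.
Qed.

End crossing_lines.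

(** * Meeting times and the recursive equation for the radii *)

Section recursive_equation.
Context (R : realType).
Implicit Types (p q r : mpoint R) (rad : mpoint R -> \bar R) (k : growth_type).
Local Open Scope ereal_scope.

Lemma rel_interior_on_line p (t : R) (x : \bar R) :
  `|t|%:E < x -> rel_interior p x (on_line p t).
Proof.
case: x => [x| |]; rewrite /= ?lte_fin; last by [].
  move=> tx; have x0 : (0 < x)%R by rewrite (le_lt_trans _ tx).
  exists (t / x)%R; last by rewrite divfK// gt_eqF.
  move: tx; rewrite ltr_norml => /andP[h1 h2]; apply/andP; split.
    by rewrite ltr_pdivlMr// mulN1r.
  by rewrite ltr_pdivrMr// mul1r.
by move=> _; exists t.
Qed.

(** Positivity of [x] matters: for radius 0 the relative interior is the location itself, not the
    empty set. *)
Lemma rel_interior_dist p (x : \bar R) z : 0 < x -> rel_interior p x z ->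
  exists2 t, z = on_line p t & `|t|%:E < x.
Proof.
case: x => [x| |] //=; last by move=> _ [t _ <-]; exists t => //; exact: ltry.
rewrite lte_fin => x0 [t /andP[h1 h2] <-]; exists (t * x)%R => //.
rewrite lte_fin normrM (gtr0_norm x0) -[ltRHS]mul1r ltr_pM2r//.
by rewrite ltr_norml h1.
Qed.

Lemma segment_on_line p (t : R) (x : \bar R) :
  `|t|%:E <= x -> segment p x (on_line p t).
Proof.
by case: x => [x| |] //=; rewrite ?lee_fin => tx; exists t.
Qed.

Lemma finite_set_min d (T : orderType d) (A : set T) :
  finite_set A -> A !=set0 -> exists2 m, A m & forall x, A x -> (m <= x)%O.
Proof.
case/finite_seqP => s ->; elim: s => [[x]//|a [|b s] IH] _.
  by exists a => [|x] /=; rewrite inE// => /eqP ->.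
case: IH => [|m ms mle]; first by exists b => /=; rewrite inE eqxx.
have [am|ma] := leP a m.
  exists a => [|x] /=; first by rewrite inE eqxx.
  by rewrite inE => /predU1P[->//|/mle]; exact: le_trans.
exists m => [|x] /=; first by rewrite inE ms orbT.
by rewrite inE => /predU1P[->|/mle//]; exact: ltW.
Qed.

(** Only the elements up to [x] compete for the infimum, and finitely many of them have a least
    one. *)
Lemma ereal_inf_attained (A : set (\bar R)) (x : \bar R) :
  ereal_inf A < x -> finite_set (A `&` [set y | y <= x]) -> A (ereal_inf A).
Proof.
move=> ax finA; have [y Ay yx] := ereal_inf_lt ax.
have [|m [Am mx] mle] := finite_set_min _ _ _ finA.
  by exists y; split => //; exact: ltW.
suff -> : ereal_inf A = m by [].
apply/eqP; rewrite eq_le; apply/andP; split; first exact: ereal_inf_lbound.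
apply: le_ereal_inf_tmp => z Az; have [zx|xz] := leP z x; first exact: mle.
by rewrite (le_trans mx)// ltW.
Qed.

Lemma finite_box (X : config R) (a b l : R) :
  finite_set [set q | [/\ points X q, `|q.1.1 - a| <= l & `|q.1.2 - b| <= l]%R].
Proof.
pose B : set (R * R) := [set x | `|x.1 - a| <= l /\ `|x.2 - b| <= l]%R.
apply: (@sub_finite_set _ _ (points X `&` [set q | B q.1])).
  by move=> q [].
apply: config_locally_finite; exists (`|a| + `|b| + l)%R.
split; first by rewrite num_real.
move=> M lM x [xa xb] /=; rewrite prod_normE ge_max; apply/andP; split.
  rewrite (le_trans _ (ltW lM))// -[x.1](subrK a) (le_trans (ler_normD _ _))//.
  by have := normr_ge0 b; lra.
rewrite (le_trans _ (ltW lM))// -[x.2](subrK b) (le_trans (ler_normD _ _))//.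
by have := normr_ge0 a; lra.
Qed.

(* By time [meet_time p q] both p and q have reached the crossing point, provided
   that neither stops earlier. *)
Definition meet_time p q : \bar R := maxe (cross_dist p q) (cross_dist q p).

(** The part of the stopping rule that does not involve the radii. For Type 1 a segment is stopped
    only by one whose location is nearer to the crossing point; for Type 2 either segment may stop
    the other. *)
Definition can_stop k p q : Prop :=
  if k is Type1 then cross_dist q p < cross_dist p q else True.

(** The infimum of this set is the right-hand side of the recursive equation. It is [+oo] for the
    empty set, so a segment that nothing stops is a whole line. *)
Definition stopping_times k (X : config R) rad p : set (\bar R) :=
  [set meet_time p q | q in
    [set q | [/\ points X q, q <> p, can_stop k p q & cross_dist q p <= rad q]]].

Lemma meet_timeC p q : meet_time p q = meet_time q p.
Proof. exact: maxC. Qed.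

Lemma cross_dist_meet_time p q : cross_dist p q <= meet_time p q.
Proof. by rewrite le_max lexx. Qed.

Lemma cross_dist_meet_timer p q : cross_dist q p <= meet_time p q.
Proof. by rewrite le_max lexx orbT. Qed.

Lemma meet_time_ge0 p q : 0 <= meet_time p q.
Proof. exact: le_trans (cross_dist_ge0 _ p q) (cross_dist_meet_time p q). Qed.

Context (X : config R)
  (tieX :
  forall p q, points X p -> points X q -> p <> q -> tie_free R p q).

Let marks p : points X p -> (p.2 : R) \in `[0%R, pi[.
Proof. by move/(config_marks (c := X)). Qed.

(** A point met by time [x] shares with [p] a crossing point within distance [x] of both, so it lies
    in a box of half-width [x + x] around [p], where the configuration is finite. *)
Lemma finite_meet_time p (x : \bar R) : points X p -> x < +oo ->
  finite_set [set q | [/\ points X q, q <> p & meet_time p q <= x]].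
Proof.
move=> Xp xoo.
have [x0|x0] := ltP x 0.
  rewrite (_ : [set _ | _] = set0)//; apply/seteqP; split => // q [_ _].
  by rewrite leNgt (lt_le_trans x0)// meet_time_ge0.
case: x x0 xoo => // x _ _.
apply: sub_finite_set (finite_box X p.1.1 p.1.2 (x + x)%R).
move=> q [Xq qp px].
have dp : cross_dist p q <= x%:E := le_trans (cross_dist_meet_time p q) px.
have dq : cross_dist q p <= x%:E := le_trans (cross_dist_meet_timer p q) px.
have nt : tie_free R p q by apply: tieX => // e; exact: qp.
have [t [s e]] := cross_dist_meet _ _ _ (marks _ Xp) (marks _ Xq) nt
  (le_lt_trans dp (ltry _)).
have [et es] := meet_cross_dist _ _ _ _ _ (marks _ Xp) (marks _ Xq) nt e.
have [h1 h2] := meet_dist_bound _ _ _ _ _ e.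
move: dp dq; rewrite et es !lee_fin => dp dq /=.
by split => //; rewrite (le_trans h1, le_trans h2)// lerD.
Qed.

Lemma stopping_times_attained k rad p : points X p ->
  ereal_inf (stopping_times k X rad p) < +oo ->
  exists q, [/\ points X q, q <> p, can_stop k p q, cross_dist q p <= rad q &
    meet_time p q = ereal_inf (stopping_times k X rad p)].
Proof.
move=> Xp; set A := stopping_times _ _ _ _ => Aoo.
have [x Ax] : exists x : R, ereal_inf A < x%:E.
  by move: Aoo; case: (ereal_inf A) => [r| |]// _;
    [exists (r + 1)%R; rewrite lte_fin ltrDl|exists 0%R; exact: ltNyr].
have /(_ _)[|q [Xq qp kq dq] <-] := ereal_inf_attained A _ Ax; last by exists q.
apply: sub_finite_set (finite_image (meet_time p) (finite_meet_time p x%:E Xp (ltry _))).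
by move=> _ [[q [Xq qp kq dq] <-] /= qx]; exists q.
Qed.

End recursive_equation.

(** * Growth-maximal models as solutions of the recursive equation *)

Section growth_maximal_models.
Context (R : realType) (k : growth_type) (X : config R).
Implicit Types (p q r : mpoint R) (rad : mpoint R -> \bar R).
Local Open Scope ereal_scope.

Definition general_position : Prop :=
  (forall p q, points X p -> points X q -> p <> q -> tie_free R p q) /\
  (forall p q r, points X p -> points X q -> points X r ->
    p <> q -> p <> r -> q <> r -> cross_dist p q < +oo ->
    cross_dist p q <> cross_dist p r /\ cross_dist p q <> cross_dist r p).

Definition recursive_radii rad : Prop :=
  forall p, points X p -> rad p = ereal_inf (stopping_times R k X rad p).

Context (gpX : general_position).

Let tieX p q : points X p -> points X q -> p <> q -> tie_free R p q.
Proof. exact: gpX.1. Qed.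

Let marks p : points X p -> (p.2 : R) \in `[0%R, pi[.
Proof. by move/(config_marks (c := X)). Qed.

Lemma gmhs_recursive rad : gmhs_model k X rad -> recursive_radii rad.
Proof.
move=> [[rad_ge0 disj] stop] p Xp; apply/eqP; rewrite eq_le; apply/andP; split.
  apply: le_ereal_inf_tmp => _ [q [Xq qp kq dq] <-].
  have pq : p <> q by move=> e; apply: qp.
  have [fin|] := ltP (meet_time R p q) +oo; last first.
    by rewrite leye_eq => /eqP ->; exact: leey.
  have [dlt|] := ltP (cross_dist q p) (rad q).
    (* Here [q] runs past the crossing point. If [p] did so too, the crossing point would lie in
       both relative interiors. *)
    rewrite (le_trans _ (cross_dist_meet_time _ p q))// leNgt; apply/negP => plt.
    have dfin := le_lt_trans (cross_dist_meet_time _ p q) fin.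
    have tpq := tieX _ _ Xp Xq pq.
    have [t [s e]] := cross_dist_meet _ _ _ (marks _ Xp) (marks _ Xq) tpq dfin.
    have [et es] := meet_cross_dist _ _ _ _ _ (marks _ Xp) (marks _ Xq) tpq e.
    suff : (rel_interior p (rad p) `&` rel_interior q (rad q)) (on_line p t).
      by rewrite disj.
    split; first by apply: rel_interior_on_line; rewrite -et.
    by rewrite e; apply: rel_interior_on_line; rewrite -es.
  move=> qle; have {qle dq} radq : rad q = cross_dist q p.
    by apply/eqP; rewrite eq_le qle dq.
  have qfin : rad q < +oo.
    by rewrite radq (le_lt_trans (cross_dist_meet_timer _ p q)).
  (* Now [q] ends exactly at the crossing point. Its stopping neighbour [r] is either [p], where the
     rules for the two types decide, or a third point, which gives a tie. *)
  have [r [[_ Xr qr _] kr]] := stop q Xq qfin.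
  have [erp|rp] := pselect (r = p).
    subst r; case: (k) kr kq => /=.
      by case=> _ h _ h'; have := lt_trans h h'; rewrite ltxx.
    by case=> -> /andP[_]; rewrite -/(meet_time R q p) meet_timeC.
  have [n1 n2] := gpX.2 q p r Xq Xp Xr qp qr (fun e => rp (esym e)) ltac:(by rewrite -radq).
  case: (k) kr => /= -[].
    by rewrite radq => /n1.
  by rewrite radq /Order.max; case: ifP => _ + _; [move/n2|move/n1].
(* For the other inequality, a stopping neighbour of [p] puts [rad p] itself among the stopping
   times. *)
have [pfin|] := ltP (rad p) +oo; last first.
  by rewrite leye_eq => /eqP ->; exact: leey.
have [q [[_ Xq pq _] kq]] := stop p Xp pfin.
apply: ereal_inf_lbound; exists q; last first.
  rewrite /meet_time; case: (k) kq => [[-> /ltW + _]|[-> _]//].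
  by rewrite maxC => /max_idPr.
split => //; first by move=> e; exact: pq.
  by case: (k) kq => // -[].
by case: (k) kq => [[_ _ /ltW]//|[_ /andP[]]].
Qed.

(** A radius that is not positive would be an attained meeting time, which forces both distances to
    be 0: a finite tie. *)
Lemma recursive_gt0 rad p : recursive_radii rad -> points X p -> 0 < rad p.
Proof.
move=> rec Xp; rewrite ltNge; apply/negP => rp.
have infp : ereal_inf (stopping_times R k X rad p) < +oo.
  by rewrite -rec// (le_lt_trans rp).
have [q [Xq qp _ _ mt]] := stopping_times_attained _ _ tieX _ _ _ Xp infp.
move: rp; rewrite rec// -mt ge_max => /andP[h1 h2].
have e1 : cross_dist p q = 0.
  by apply/eqP; rewrite eq_le h1 cross_dist_ge0.
have e2 : cross_dist q p = 0.
  by apply/eqP; rewrite eq_le h2 cross_dist_ge0.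
by have := tieX _ _ Xp Xq (fun e => qp (esym e)); rewrite /tie_free e1 e2 => /(_ erefl).
Qed.

Lemma recursive_le rad p q : recursive_radii rad -> points X p -> points X q ->
  q <> p -> can_stop R k p q -> cross_dist q p <= rad q ->
  rad p <= meet_time R p q.
Proof.
by move=> rec Xp Xq qp kq dq; rewrite rec//; apply: ereal_inf_lbound; exists q.
Qed.

Lemma recursive_gmhs rad : recursive_radii rad -> gmhs_model k X rad.
Proof.
move=> rec; split.
  split=> [p Xp|p q Xp Xq pq]; first exact/ltW/recursive_gt0.
  apply/eqP/negPn/negP => /set0P[z [zp zq]].
  have [t zt tp] := rel_interior_dist _ _ _ _ (recursive_gt0 _ _ rec Xp) zp.
  have [s zs sq] := rel_interior_dist _ _ _ _ (recursive_gt0 _ _ rec Xq) zq.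
  have e : on_line p t = on_line q s by rewrite -zt.
  have [et es] := meet_cross_dist _ _ _ _ _ (marks _ Xp) (marks _ Xq)
    (tieX _ _ Xp Xq pq) e.
  (* Of two segments running past their crossing point, the one with the longer way to it should
     have been stopped there. *)
  have H p1 p2 : points X p1 -> points X p2 -> p2 <> p1 ->
      cross_dist p1 p2 < rad p1 -> cross_dist p2 p1 < rad p2 ->
      cross_dist p2 p1 < cross_dist p1 p2 -> False.
    move=> X1 X2 n12 l1 l2 l12.
    have : rad p1 <= meet_time R p1 p2.
      apply: recursive_le => //; last exact: ltW.
      by rewrite /can_stop; case: (k).
    rewrite /meet_time max_l; last exact: ltW.
    by rewrite leNgt l1.
  have [l12|l21|e12] := ltgtP (cross_dist q p) (cross_dist p q).
  - by apply: (H p q) => //; [exact: nesym|rewrite et|rewrite es].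
  - by apply: (H q p) => //; [rewrite es|rewrite et].
  - have := tieX _ _ Xp Xq pq (esym e12).
    by rewrite et.
move=> p Xp pfin.
have infp : ereal_inf (stopping_times R k X rad p) < +oo by rewrite -rec.
have [q [Xq qp kq dq mt]] := stopping_times_attained _ _ tieX _ _ _ Xp infp.
rewrite -rec// in mt.
have dp : cross_dist p q <= rad p by rewrite -mt cross_dist_meet_time.
have pq : p <> q by exact: nesym.
exists q; split.
  split => //.
  have [t [s e]] := cross_dist_meet _ _ _ (marks _ Xp) (marks _ Xq)
    (tieX _ _ Xp Xq pq) (le_lt_trans dp pfin).
  have [et es] := meet_cross_dist _ _ _ _ _ (marks _ Xp) (marks _ Xq)
    (tieX _ _ Xp Xq pq) e.
  exists (on_line p t); split; first by apply: segment_on_line; rewrite -et.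
  by rewrite e; apply: segment_on_line; rewrite -es.
have [ek|ek] : k = Type1 \/ k = Type2 by case: (k); [left|right].
  rewrite ek; have := kq; rewrite ek /= => ltqp.
  have mtp : meet_time R p q = cross_dist p q by rewrite /meet_time max_l// ltW.
  split => //; first by rewrite -mt mtp.
  (* If [q] ended exactly at the crossing point, the point [r] that attains the infimum for [q]
     would have [cross_dist q r = cross_dist q p]: a tie, unless [r] is [p], which is too far from
     the crossing point to stop [q]. *)
  rewrite lt_neqAle dq andbT; apply/eqP => dqe.
  have qfin : ereal_inf (stopping_times R k X rad q) < +oo.
    by rewrite -rec// -dqe (lt_trans ltqp)// (le_lt_trans dp).
  have [r [Xr rq kr _ mr]] := stopping_times_attained _ _ tieX _ _ _ Xq qfin.
  move: kr; rewrite ek /= => ltrq.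
  move: mr; rewrite -rec// -dqe /meet_time max_l; last exact: ltW.
  have [erp|rp] := pselect (r = p).
    by move: ltrq; rewrite erp ltNge => /negP[]; exact: ltW.
  have dqfin : cross_dist q p < +oo by rewrite (lt_trans ltqp)// (le_lt_trans dp).
  by have [n1 _] := gpX.2 q p r Xq Xp Xr qp (nesym rq) (nesym rp) dqfin => /esym.
rewrite ek; split; first by rewrite -mt.
(* The Type 2 rule is symmetric: [p] reaches the crossing point as well, so it stops [q] no later
   than their meeting time. *)
rewrite dq -mt meet_timeC; apply: (recursive_le rad) => //.
by rewrite ek.
Qed.

(** A pair [(p, s)] stands for the question whether [s <= rad p]; the pairs preceding it are the
    questions on which the answer depends. The type is left out, so one chain condition serves both
    types. *)
Definition precedes (y x : mpoint R * \bar R) : Prop :=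
  [/\ points X y.1, y.1 <> x.1, meet_time R x.1 y.1 < x.2 &
      y.2 = cross_dist y.1 x.1].

Definition no_descending_chain : Prop :=
  ~ exists f : nat -> mpoint R * \bar R,
    points X (f 0%N).1 /\ forall n, precedes (f n.+1) (f n).

(** An inaccessible pair has an inaccessible predecessor, and dependent choice strings these into an
    infinite chain. *)
Lemma precedes_wf : no_descending_chain -> forall x, points X x.1 -> Acc precedes x.
Proof.
move=> nochain x Xx; apply: contrapT => nacc; apply: nochain.
pose T := {y : mpoint R * \bar R | points X y.1 /\ ~ Acc precedes y}.
have step (y : T) : {z : T | precedes (sval z) (sval y)}.
  apply: cid; case: y => y [Xy ny] /=; apply: contrapT => H; apply: ny.
  constructor => z zy; apply: contrapT => nz; apply: H.
  have Xz : points X z.1 by case: zy.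
  by exists (exist _ z (conj Xz nz)).
have [f [f0 fS]] := dependent_choice step (exist _ x (conj Xx nacc)).
by exists (fun n => sval (f n)); split => //; rewrite f0.
Qed.

(** The right-hand side compares radii only at pairs preceding [(p, s)], so induction along
    [precedes] applies. *)
Lemma le_recursive rad p (s : \bar R) : recursive_radii rad -> points X p ->
  s <= rad p <-> forall q, points X q -> q <> p -> can_stop R k p q ->
    meet_time R p q < s -> ~ (cross_dist q p <= rad q).
Proof.
move=> rec Xp; split=> [sp q Xq qp kq mts dq|H].
  have := lt_le_trans mts sp; rewrite ltNge => /negP; apply.
  exact: recursive_le.
rewrite rec//; apply: le_ereal_inf_tmp => _ [q [Xq qp kq dq] <-].
by rewrite leNgt; apply/negP => /(H q Xq qp kq).
Qed.

Lemma recursive_radii_unique rad rad' : no_descending_chain ->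
  recursive_radii rad -> recursive_radii rad' ->
  forall p, points X p -> rad p = rad' p.
Proof.
move=> nochain rec rec'.
have H x : points X x.1 -> x.2 <= rad x.1 <-> x.2 <= rad' x.1.
  move=> Xx; have := precedes_wf nochain x Xx.
  move: Xx => /[swap]; elim=> {}x _ IH Xx.
  rewrite (le_recursive _ _ _ rec Xx) (le_recursive _ _ _ rec' Xx).
  split=> H q Xq qp kq mt; have := H q Xq qp kq mt; apply: contra_not;
    by apply (IH (q, cross_dist q x.1)).
(* Both radii pass the same thresholds; each of them is now taken as the threshold for the other. *)
move=> p Xp; apply/eqP; rewrite eq_le; apply/andP; split.
  by apply/(H (p, rad p)).
by apply/(H (p, rad' p)).
Qed.

Lemma recursive_radii_exist : no_descending_chain ->
  exists rad, recursive_radii rad.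
Proof.
move=> nochain.
(* With the restriction to pairs over [X] the relation is well founded on the whole type, as [Fix]
   requires. *)
have wfP : well_founded (fun y x => points X x.1 /\ precedes y x).
  move=> x; constructor => y [Xx yx].
  have : Acc precedes y by apply: precedes_wf => //; case: yx.
  by elim=> {yx}y _ IH; constructor => z [_ zy]; exact: IH.
pose F x (rec : forall y, points X x.1 /\ precedes y x -> Prop) :=
  forall y (yx : points X x.1 /\ precedes y x), can_stop R k x.1 y.1 -> ~ rec y yx.
(* [reaches (p, s)] is to mean [s <= rad p]. *)
pose reaches := Fix wfP (fun=> Prop) F.
have reachesE x : points X x.1 -> reaches x <->
    forall y, precedes y x -> can_stop R k x.1 y.1 -> ~ reaches y.
  move=> Xx; rewrite /reaches Fix_eq; last first.
    move=> y f g fg; congr F; apply/functional_extensionality_dep => z.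
    by apply/functional_extensionality_dep => yz.
  by split=> H y yx; [exact: (H y (conj Xx yx))|case: yx => _; exact: H].
exists (fun p => ereal_inf [set meet_time R p q | q in
  [set q | [/\ points X q, q <> p, can_stop R k p q & reaches (q, cross_dist q p)]]]).
set rad := fun p => _.
(* This identifies [reaches (q, cross_dist q p)] with [cross_dist q p <= rad q], which turns the
   definition of [rad] into the recursive equation. *)
have radP p s : points X p -> s <= rad p <-> reaches (p, s).
  move=> Xp; rewrite reachesE//; split=> [sp [q t] [/= Xq qp mt ->] kq rq|H].
    have := lt_le_trans mt sp; rewrite ltNge => /negP; apply.
    by apply: ereal_inf_lbound; exists q.
  apply: le_ereal_inf_tmp => _ [q [Xq qp kq rq] <-].
  rewrite leNgt; apply/negP => mt.
  exact: (H (q, cross_dist q p)).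
move=> p Xp; congr ereal_inf; apply/seteqP; split=> _ [q [Xq qp kq dq] <-].
  by exists q => //; split => //; apply/radP.
by exists q => //; split => //; apply/radP.
Qed.

Lemma gmhs_exists_unique : no_descending_chain -> exists_unique_gmhs_model k X.
Proof.
move=> nochain; have [rad rec] := recursive_radii_exist nochain.
exists rad; first exact: recursive_gmhs.
move=> rad' /gmhs_recursive rec' p Xp; exact: recursive_radii_unique rec' rec p Xp.
Qed.

End growth_maximal_models.

(** * From an infinite chain to arbitrarily long simple paths *)

Section simple_paths.
Context (R : realType).
Implicit Types (p q r : mpoint R) (T h : R) (m : nat).

(* Up to the factor [sin], the last condition says that [cross_dist q p] lies in
   [(m - 1) h, m h]; for equal marks it degenerates to [wedge p q p.2 = 0]. *)
Definition edge T h m : set (mpoint R * mpoint R) :=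
  [set x | [/\ `|x.2.1.1 - x.1.1.1| <= T + T, `|x.2.1.2 - x.1.1.2| <= T + T &
    (m%:R - 1) * h * `|sin (x.2.2 - x.1.2)| <= `|wedge R x.1 x.2 x.1.2|
      <= m%:R * h * `|sin (x.2.2 - x.1.2)|]].

Definition edge_rel T h m : rel (mpoint R) := fun p q => `[< edge T h m (p, q) >].

(** The path may change with [n], but all roots lie in one box. Its size [N] is an integer so that
    countably many events suffice. *)
Definition long_paths (X : config R) T h m (N : nat) : Prop :=
  forall n, exists p (t : seq (mpoint R)),
    [/\ size t = n, uniq (p :: t), {in p :: t, forall q, points X q},
        `|p.1.1| <= N%:R /\ `|p.1.2| <= N%:R & path (edge_rel T h m) p t].

Lemma path_edge_dist T h m p t : 0 <= T -> path (edge_rel T h m) p t ->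
  `|(last p t).1.1 - p.1.1| <= (size t)%:R * (T + T) /\
  `|(last p t).1.2 - p.1.2| <= (size t)%:R * (T + T).
Proof.
move=> T0; elim: t p => [|q t IH] p /=; first by rewrite !subrr normr0 mul0r.
case/andP => /asboolP[/= h1 h2 _] /IH[h3 h4].
rewrite -natr1 mulrDl mul1r; split.
  by rewrite -[_.1.1](subrK q.1.1) -addrA (le_trans (ler_normD _ _))// lerD.
by rewrite -[_.1.2](subrK q.1.2) -addrA (le_trans (ler_normD _ _))// lerD.
Qed.

Lemma simple_path_of_walk (X : config R) T h m (Y : nat -> mpoint R) (v : nat -> \bar R)
    (w : mpoint R -> mpoint R -> \bar R) :
  0 <= T -> (forall n, points X (Y n)) ->
  (forall n, edge T h m (Y n, Y n.+1)) ->
  (forall n, v n = w (Y n) (Y n.+1)) -> (forall n, (v n.+1 < v n)%E) ->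
  forall n, exists t, [/\ size t = n, uniq (Y 0%N :: t),
    {in Y 0%N :: t, forall q, points X q} & path (edge_rel T h m) (Y 0%N) t].
Proof.
(* If removing loops never left n steps, the walk would stay among finitely many
   points, and [v] would take finitely many values. *)
move=> T0 XY eY vw vlt n; apply: contrapT => H.
have walk L : path (edge_rel T h m) (Y 0%N) (map Y (iota 1 L)).
  suff : forall i, path (edge_rel T h m) (Y i) (map Y (iota i.+1 L)) by [].
  by elim: L => //= L IH i; rewrite IH andbT; apply/asboolP.
have near L : `|(Y L).1.1 - (Y 0%N).1.1| <= n%:R * (T + T) /\
              `|(Y L).1.2 - (Y 0%N).1.2| <= n%:R * (T + T).
  have -> : Y L = last (Y 0%N) (map Y (iota 1 L)).
    rewrite last_map; congr Y; case: L => // L.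
    by rewrite -nth_last size_iota nth_iota.
  (* Removing loops keeps the end point [Y L]. A result with at least [n] steps could be cut to [n]
     steps, against [H]. *)
  case/shortenP: (walk L) => t pt ut sub.
  have [tn|nt] := ltnP (size t) n; last first.
    case: H; exists (take n t); split.
    - by rewrite size_takel.
    - by have := take_uniq n.+1 ut.
    - move=> q; rewrite inE => /predU1P[->//|/mem_take/sub].
      by case/mapP => i _ ->.
    - exact: take_path.
  have [h1 h2] := path_edge_dist _ _ _ _ _ T0 pt.
  by split; [apply: le_trans h1 _|apply: le_trans h2 _];
    rewrite ler_wpM2r ?addr_ge0// ler_nat ltnW.
pose F := [set q | [/\ points X q, `|q.1.1 - (Y 0%N).1.1| <= n%:R * (T + T) &
   `|q.1.2 - (Y 0%N).1.2| <= n%:R * (T + T)]].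
have finF : finite_set F by exact: finite_box.
have YF L : F (Y L) by have [] := near L.
have finV : finite_set (range v).
  apply: sub_finite_set (finite_image (fun x => w x.1 x.2) (finite_setX finF finF)).
  move=> _ [L _ <-]; exists (Y L, Y L.+1); last by rewrite vw.
  by split; exact: YF.
have [|_ [L _ <-] vmin] := finite_set_min _ _ _ finV; first by exists (v 0%N), 0%N.
have : (v L <= v L.+1)%E by apply: vmin; exists L.+1.
by rewrite leNgt vlt.
Qed.

(** Since [|wedge p q p.2|] is [s] times [|sin (q.2 - p.2)|], the bounds on [s] only have to be
    multiplied by the sine. *)
Lemma edge_of_cross_dist T h m p q (s : R) : p.2 \in `[0, pi[ -> q.2 \in `[0, pi[ ->
  tie_free R p q -> (meet_time R p q <= T%:E)%E -> cross_dist q p = s%:E ->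
  (m%:R - 1) * h <= s <= m%:R * h -> edge T h m (p, q).
Proof.
move=> hp hq nt mt sE /andP[s1 s2].
have dp := le_trans (cross_dist_meet_time _ p q) mt.
have dq := le_trans (cross_dist_meet_timer _ p q) mt.
have [t [u e]] := cross_dist_meet _ _ _ hp hq nt (le_lt_trans dp (ltry _)).
have [et es] := meet_cross_dist _ _ _ _ _ hp hq nt e.
have [_ wu] := on_line_meet _ _ _ _ _ e.
have [h1 h2] := meet_dist_bound _ _ _ _ _ e.
move: dp dq; rewrite et es !lee_fin => dp dq.
move: es; rewrite sE => -[us].
split=> /=; first by rewrite (le_trans h1)// lerD.
  by rewrite (le_trans h2)// lerD.
by rewrite -wu normrM -us !ler_wpM2r.
Qed.

Lemma long_paths_of_chain (X : config R) :
  general_position R X -> ~ no_descending_chain R X ->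
  exists T : nat, forall h, 0 < h -> exists m N, long_paths X T%:R h m N.
Proof.
move=> gpX /contrapT[f [Xf0 fS]].
have tieX p q : points X p -> points X q -> p <> q -> tie_free R p q by exact: gpX.1.
have marks p : points X p -> (p.2 : R) \in `[0, pi[.
  by move/(config_marks (c := X)).
have Xf n : points X (f n).1 by case: n => // n; case: (fS n).
have slt n : ((f n.+1).2 < (f n).2)%E.
  by case: (fS n) => _ _ mt ->; rewrite (le_lt_trans _ mt)// cross_dist_meet_timer.
have sge0 n : (0 <= (f n.+1).2)%E by case: (fS n) => _ _ _ ->; exact: cross_dist_ge0.
(* The sequence starts at index 1 of the chain because the initial threshold [(f 0).2] may be
   infinite. *)
pose r n := fine (f n.+1).2.
have rE n : (f n.+1).2 = (r n)%:E.
  by rewrite fineK// ge0_fin_numE// (lt_le_trans (slt n))// leey.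
have rlt n : r n.+1 < r n by rewrite -lte_fin -!rE.
have r_ge0 n : 0 <= r n by rewrite -lee_fin -rE.
have rle i j : (i <= j)%N -> r j <= r i.
  by move/subnK <-; elim: (j - i)%N => // l; apply: le_trans; exact/ltW/rlt.
have natP (x : R) : exists i : nat, x <= i%:R.
  exists `|Num.ceil x|%N.
  by rewrite natr_absz (le_trans (ceil_ge x))// ler_int ler_norm.
(* [T] bounds all later meeting times and is fixed before [h], so that [h] may be chosen small in
   terms of [T]. *)
have [T rT] := natP (r 0%N); exists T => h h0.
have exm : exists m, `[< exists n, r n <= m%:R * h >].
  have [i hi] := natP (r 0%N / h); exists i; apply/asboolP; exists 0%N.
  by rewrite -ler_pdivrMr.
(* With the least [m] such that some [r n] is at most [m h], no later term can fall below
   [(m - 1) h]. *)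
case: (ex_minnP exm) => m /asboolP[n0 rn0] mmin.
have rI n : (n0 <= n)%N -> (m%:R - 1) * h <= r n <= m%:R * h.
  move=> nn; rewrite (le_trans (rle _ _ nn) rn0) andbT.
  rewrite leNgt; apply/negP => rm.
  (* For [m = 0] the lower bound is [- h], and nonnegativity of [r n] suffices. *)
  case: m mmin rn0 rm => [|m] mmin rn0 rm.
    by have := r_ge0 n; move: rm; rewrite sub0r mulN1r; lra.
  have /mmin : `[< exists n, r n <= m%:R * h >].
    by apply/asboolP; exists n; rewrite ltW// -[m%:R](addrK 1) natr1.
  by rewrite ltnn.
(* The shift by one makes the threshold that bounds the meeting time of [Y n] and [Y n.+1] equal to
   the finite number [r (n0 + n)]. *)
pose Y n := (f (n0 + n).+1).1.
have edgeY n : edge T%:R h m (Y n, Y n.+1).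
  have [_ ne mt dE] := fS (n0 + n).+1.
  apply: (@edge_of_cross_dist _ _ _ _ _ (r (n0 + n).+1)).
  - by rewrite /Y; exact/marks.
  - by rewrite /Y; exact/marks.
  - by apply: tieX; [exact: Xf|exact: Xf|rewrite /Y addnS; exact: nesym].
  - rewrite /Y addnS ltW// (lt_le_trans mt)// rE lee_fin.
    by rewrite (le_trans _ rT)// rle.
  - by rewrite /Y addnS -dE rE.
  - by apply: rI; rewrite -addnS leq_addr.
have [N1 hN1] := natP `|(Y 0%N).1.1|.
have [N2 hN2] := natP `|(Y 0%N).1.2|.
exists m, (N1 + N2)%N => n.
have [|||t [st ut Xt pt]] := simple_path_of_walk X T%:R h m Y (fun n => (f (n0 + n).+2).2)
   (fun p q => cross_dist q p) (ler0n _ _) _ edgeY _ _ n => //.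
- by move=> i; exact: Xf.
- by move=> i; rewrite /Y addnS; have [_ _ _ ->] := fS (n0 + i).+1.
- by move=> i; rewrite addnS; exact: slt.
exists (Y 0%N), t; split => //; rewrite natrD; split.
  by rewrite (le_trans hN1)// lerDl.
by rewrite (le_trans hN2)// lerDr.
Qed.

End simple_paths.

(** * Measurability of hitting events *)

Section configuration_events.
Context (R : realType).
Local Open Scope ereal_scope.

Lemma measurable_mpoint1 (p : mpoint R) : measurable [set p].
Proof.
have -> : [set p] = ([set p.1.1] `*` [set p.1.2]) `*` [set p.2].
  apply/seteqP; split=> [_ ->//|[[x y] th] /= [[-> ->] ->]].
  by case: p => [[]].
by apply: measurableX; [apply: measurableX|]; exact: measurable_set1.
Qed.

Lemma measurable_points (X : config R) : measurable (points X).
Proof.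
by apply: countable_measurable (config_countable X); exact: measurable_mpoint1.
Qed.

Lemma counting_eq0 (T : choiceType) (A : set T) :
  counting A = 0 :> \bar R -> A = set0.
Proof.
rewrite /counting; case: ifPn => // /asboolP finA [] /eqP.
by rewrite pnatr_eq0 finmap.cardfs_eq0 => /eqP; exact: fset_set_set0.
Qed.

(** [card_in] with its arguments exchanged, so that it can carry the structure of a measure. *)
Definition config_measure (X : config R) (A : set (mpoint R)) : \bar R :=
  card_in A X.

Section is_measure.
Context (X : config R).

Let config_measure0 : config_measure X set0 = 0.
Proof. by rewrite /config_measure /card_in setI0 measure0. Qed.

Let config_measure_ge0 A : 0 <= config_measure X A.
Proof. exact: (measure_ge0 (@counting (mpoint R) R)). Qed.

Let config_measure_additive : semi_sigma_additive (config_measure X).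
Proof.
move=> F mF tF mUF; rewrite /config_measure /card_in setI_bigcupr.
apply: (@measure_semi_sigma_additive _ _ _ (@counting (mpoint R) R)
  (fun i => points X `&` F i)).
- by move=> i; apply: measurableI => //; exact: measurable_points.
- exact: trivIset_setIl.
- by apply: bigcupT_measurable => i; apply: measurableI => //; exact: measurable_points.
Qed.

HB.instance Definition _ := isMeasure.Build _ _ _ (config_measure X)
  config_measure0 config_measure_ge0 config_measure_additive.

End is_measure.

Definition centered_box (l : R) : set (mpoint R) :=
  [set p | `|p.1.1| <= l /\ `|p.1.2| <= l]%R.

Lemma measurable_abs_le d (T : measurableType d) (f : T -> R) (l : R) :
  measurable_fun setT f -> measurable [set x | `|f x| <= l]%R.
Proof.
move=> mf; have : measurable_fun setT (fun x => `|f x|)%R.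
  exact: measurableT_comp.
move=> /(_ measurableT _ (measurable_itv `]-oo, l])); rewrite setTI.
by congr measurable; apply/seteqP; split => x /=; rewrite in_itv.
Qed.

Lemma measurable_centered_box l : measurable (centered_box l).
Proof.
apply: measurableI; apply: measurable_abs_le.
  exact: (measurableT_comp measurable_fst measurable_fst).
exact: (measurableT_comp measurable_snd measurable_fst).
Qed.

Lemma finite_centered_box (X : config R) l : finite_set (points X `&` centered_box l).
Proof.
apply: sub_finite_set (finite_box R X 0 0 l) => p [Xp [h1 h2]].
by rewrite /= !subr0.
Qed.

Section hitting.
Context d (Z : measurableType d) (X : Z -> config R)
  (mX : forall C, measurable C -> measurable_fun setT (fun z => card_in C (X z))).

Let k (z : Z) : {measure set (mpoint R) -> \bar R} := config_measure (X z).

Let measurable_k U : measurable U -> measurable_fun [set: Z] (k ^~ U).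
Proof. exact: mX. Qed.

HB.instance Definition _ := isKernel.Build _ _ _ _ _ k measurable_k.

(** A projection of a measurable set need not be measurable, so points are counted: [C] is hit over
    [z] when the section of [C] at [z] contains a positive number of points in some box. *)
Lemma measurable_hit (C : set (Z * mpoint R)) : measurable C ->
  measurable [set z | exists p, points (X z) p /\ C (z, p)].
Proof.
move=> mC.
pose phi N z := card_in (xsection C z `&` centered_box N%:R) (X z).
have mphi N : measurable_fun setT (phi N).
  (* Inside a box each configuration is a finite measure; then the measure of a section of [C] is
     measurable in [z]. *)
  have bounded z : exists M, forall U, measurable U ->
      mrestr (k z) (measurable_centered_box N%:R) U < M%:E.
    have fin : finite_set (points (X z) `&` centered_box N%:R)
      by exact: finite_centered_box.
    exists (fine (k z (centered_box N%:R)) + 1)%R => U mU.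
    have kfin : k z (centered_box N%:R) \is a fin_num.
      by rewrite /k /= /config_measure /card_in /counting asboolT.
    rewrite EFinD fineK// lte_spadder// /mrestr le_measure// inE//.
      by apply: measurableI => //; exact: measurable_centered_box.
    exact: measurable_centered_box.
  by have [_] := measurable_prod_subset_xsection_kernel bounded mC.
rewrite (_ : [set z | _] = \bigcup_N (phi N @^-1` ~` [set 0])).
  apply: bigcupT_measurable => N; rewrite -[_ @^-1` _]setTI.
  by apply: mphi => //; apply: measurableC; exact: emeasurable_set1.
apply/seteqP; split=> [z /= [p [Xp Cp]]|z [N _ /= phi0]].
  exists (`|Num.ceil (`|p.1.1| + `|p.1.2|)|%N) => //= /counting_eq0.
  apply/eqP/set0P; exists p; split => //; split; first by rewrite /xsection /= inE.
  have le : (`|p.1.1| + `|p.1.2| <= (`|Num.ceil (`|p.1.1| + `|p.1.2|)|%N)%:R)%R.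
    by rewrite natr_absz (le_trans (ceil_ge _))// ler_int ler_norm.
  by split; rewrite (le_trans _ le)// ?lerDl ?lerDr.
apply: contrapT => H; apply: phi0; rewrite /phi /card_in.
rewrite (_ : _ `&` _ = set0) ?measure0//.
apply/seteqP; split => // p [Xp [Cp _]]; apply: H; exists p; split => //.
by move: Cp; rewrite /xsection /= inE.
Qed.
End hitting.

End configuration_events.

(** * Events about tuples of points and the first moment bound *)

Section tuple_events.
Context (R : realType).

(** Induction on [n] moves the first point of the tuple into the parameter, hence the quantification
    over all parameter spaces [Z]. *)
Lemma measurable_tuple_hit n : forall d (Z : measurableType d) (X : Z -> config R),
  (forall C, measurable C -> measurable_fun setT (fun z => card_in C (X z))) ->
  forall C : set (Z * n.-tuple (mpoint R)), measurable C ->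
  measurable [set z | exists t, (forall i, points (X z) (tnth t i)) /\ C (z, t)].
Proof.
elim: n => [|n IH] d Z X mX C mC.
  rewrite (_ : [set z | _] = (fun z => (z, [tuple])) @^-1` C).
    by rewrite -[_ @^-1` _]setTI; exact: measurable_fun_pair.
  apply/seteqP; split=> z /=; first by move=> [t [_]]; rewrite tuple0.
  by exists [tuple]; split => // -[].
pose f (x : (Z * mpoint R) * n.-tuple (mpoint R)) :=
  (x.1.1, [the n.+1.-tuple (mpoint R) of x.1.2 :: x.2]).
have mf : measurable_fun setT f.
  apply: measurable_fun_pair; first exact: (measurableT_comp measurable_fst measurable_fst).
  apply: measurable_cons => //.
  exact: (measurableT_comp measurable_snd measurable_fst).
pose D := [set x | exists t : n.-tuple (mpoint R),
  (forall i, points (X x.1) (tnth t i)) /\ (f @^-1` C) (x, t)].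
have mD : measurable D.
  apply: (IH _ _ (fun x => X x.1)).
    by move=> A mA; exact: (measurableT_comp (mX A mA) measurable_fst).
  by rewrite -[_ @^-1` _]setTI; exact: mf.
rewrite (_ : [set z | _] = [set z | exists p, points (X z) p /\ D (z, p)]).
  exact: measurable_hit.
apply/seteqP; split=> [z [t [Xt Ct]]|z [p [Xp [t [Xt Ct]]]]].
  case/tupleP: t Xt Ct => p t Xt Ct; exists p; split; first exact: (Xt ord0).
  by exists t; split => [i|]; [have := Xt (lift ord0 i); rewrite tnthS|].
exists [tuple of p :: t]; split => // i.
case: (unliftP ord0 i) => [j|] ->; last by [].
by rewrite tnthS.
Qed.

Lemma measurable_eq_fun d (T : measurableType d) (f g : T -> R) :
  measurable_fun setT f -> measurable_fun setT g ->
  measurable [set x | f x = g x].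
Proof.
move=> mf mg.
have := measurable_funB mf mg => /(_ measurableT _ (measurable_set1 0)).
rewrite setTI; congr measurable; apply/seteqP; split=> x /=.
  by move/eqP; rewrite subr_eq0 => /eqP.
by move=> ->; rewrite subrr.
Qed.

Lemma measurable_diagonal :
  measurable [set x : mpoint R * mpoint R | x.1 = x.2].
Proof.
have m111 : measurable_fun setT (fun x : mpoint R * mpoint R => x.1.1.1 : R).
  exact: (measurableT_comp measurable_fst (measurableT_comp measurable_fst measurable_fst)).
have m112 : measurable_fun setT (fun x : mpoint R * mpoint R => x.1.1.2 : R).
  exact: (measurableT_comp measurable_snd (measurableT_comp measurable_fst measurable_fst)).
have m12 : measurable_fun setT (fun x : mpoint R * mpoint R => x.1.2 : R).
  exact: (measurableT_comp measurable_snd measurable_fst).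
have m211 : measurable_fun setT (fun x : mpoint R * mpoint R => x.2.1.1 : R).
  exact: (measurableT_comp measurable_fst (measurableT_comp measurable_fst measurable_snd)).
have m212 : measurable_fun setT (fun x : mpoint R * mpoint R => x.2.1.2 : R).
  exact: (measurableT_comp measurable_snd (measurableT_comp measurable_fst measurable_snd)).
have m22 : measurable_fun setT (fun x : mpoint R * mpoint R => x.2.2 : R).
  exact: (measurableT_comp measurable_snd measurable_snd).
have mI := measurableI _ _ (measurableI _ _ (measurable_eq_fun _ _ _ _ m111 m211)
   (measurable_eq_fun _ _ _ _ m112 m212)) (measurable_eq_fun _ _ _ _ m12 m22).
congr measurable: mI; apply/seteqP; split=> -[[[x y] th] [[x' y'] th']] /=.
  by move=> [[-> ->] ->].
by case=> -> -> ->.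
Qed.

Lemma measurable_tnth2 d (T : measurableType d) n (i j : 'I_n) (E : set (T * T)) :
  measurable E -> measurable [set t : n.-tuple T | E (tnth t i, tnth t j)].
Proof.
move=> mE.
have mf : measurable_fun setT (fun t : n.-tuple T => (tnth t i, tnth t j)).
  by apply: measurable_fun_pair; exact: measurable_tnth.
by have := mf measurableT _ mE; rewrite setTI.
Qed.

Lemma measurable_uniq n : measurable [set t : n.-tuple (mpoint R) | uniq t].
Proof.
have -> : [set t : n.-tuple (mpoint R) | uniq t] =
    \bigcap_(i in [set: 'I_n]) \bigcap_(j in [set j : 'I_n | i != j])
      [set t : n.-tuple (mpoint R) | (~` [set x | x.1 = x.2]) (tnth t i, tnth t j)].
  apply/seteqP; split=> [t /tuple_uniqP inj i _ j ij /=|t H].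
    by move=> /inj e; move: ij; rewrite e /= eqxx.
  apply/tuple_uniqP => i j e; apply/eqP/negPn/negP => ij.
  exact: (H i I j ij).
apply: fin_bigcap_measurable => // i _.
apply: fin_bigcap_measurable => // j _.
apply: measurable_tnth2; apply: measurableC; exact: measurable_diagonal.
Qed.

Lemma ge0_le_integralT d (T : measurableType d) (mu : {measure set T -> \bar R})
    (f g : T -> \bar R) :
  (forall x, 0 <= f x)%E -> (forall x, f x <= g x)%E ->
  (\int[mu]_x f x <= \int[mu]_x g x)%E.
Proof.
move=> f0 fg; have g0 x : (0 <= g x)%E by exact: le_trans (fg x).
rewrite !ge0_integralTE//; apply: ge_ereal_sup => _ [h hf <-].
apply: ereal_sup_ubound; exists h => // x; exact: le_trans (hf x) (fg x).
Qed.

Context d (W : measurableType d) (P : probability W R)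
  (Psi : {mfun W >-> config_space R}).

Definition tuple_event n (C : set (n.-tuple (mpoint R))) : set W :=
  [set w | exists t, distinct_tuples (Psi w) t /\ C t].

Lemma measurable_card_in C : measurable C ->
  measurable_fun setT (fun w => card_in C (Psi w)).
Proof.
move=> mC _ B mB.
have : measurable (Psi @^-1` (card_in C @^-1` B)).
  rewrite -[_ @^-1` _]setTI; apply: measurable_funPT => //.
  by apply: sub_sigma_algebra; exists C => //; exists B.
by rewrite setTI.
Qed.

Lemma measurable_tuple_event n (C : set (n.-tuple (mpoint R))) :
  measurable C -> measurable (tuple_event n C).
Proof.
move=> mC; pose D : set (W * n.-tuple (mpoint R)) :=
  setT `*` ([set t : n.-tuple (mpoint R) | uniq t] `&` C).
have mD : measurable D.
  by apply: measurableX => //; apply: measurableI => //; exact: measurable_uniq.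
have := measurable_tuple_hit n _ _ (fun w => Psi w) measurable_card_in D mD.
congr measurable; apply/seteqP; split=> w /= [t].
  by move=> [Xt [_ [ut Ct]]]; exists t.
by move=> [[ut Xt] Ct]; exists t.
Qed.

(** The indicator of the event is at most the number of tuples of distinct points that lie in
    [C]. *)
Lemma tuple_event_le n (C : set (n.-tuple (mpoint R))) : measurable C ->
  (P (tuple_event n C) <= factorial_moment P Psi C)%E.
Proof.
move=> mC; have mE := measurable_tuple_event _ _ mC.
have -> : P (tuple_event n C) = (\int[P]_w (\1_(tuple_event n C) w)%:E)%E.
  by rewrite integral_indic// setIT.
(* The integrand of [factorial_moment] has not been shown to be measurable. *)
apply: ge0_le_integralT => w; first by rewrite lee_fin.
rewrite indicE; have [/set_mem [t [Xt Ct]]|_] := boolP (w \in tuple_event n C).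
  apply: (@le_trans _ _ ((\1_C t)%:E)); first by rewrite indicE mem_set.
  apply: esum_ge; exists [set t]; last by rewrite fsbig_set1.
  by split; [exact: finite_set1|move=> _ ->].
by apply: esum_ge0 => t _; rewrite lee_fin.
Qed.

End tuple_events.

(** * Iterated integrals over tuples *)

Section power_measures.
Context (R : realType) d (T : measurableType d) (mu : {measure set T -> \bar R}).
Local Open Scope ereal_scope.

Lemma power_measure_ge0 n (C : set (n.-tuple T)) : 0 <= power_measure mu C.
Proof.
by elim: n C => [|n IH] C /=; [exact: measure_ge0|exact: integral_ge0].
Qed.

Lemma power_measure0 n : power_measure mu (set0 : set (n.-tuple T)) = 0.
Proof. by elim: n => [|n IH] /=; [exact: measure0|exact: integral0_eq]. Qed.

Lemma power_measureS_eq0 n (C : set (n.+1.-tuple T)) :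
  (forall x, power_measure mu [set t : n.-tuple T | C [tuple of x :: t]] = 0) ->
  power_measure mu C = 0.
Proof. by move=> H /=; apply: integral0_eq => x _; exact: H. Qed.

Lemma power_measure1 (C : set (1.-tuple T)) (A : set T) : measurable A ->
  (forall x, C [tuple of [:: x]] <-> A x) -> power_measure mu C = mu A.
Proof.
move=> mA CA /=; rewrite -[in RHS](setIT A) -integral_indic//.
apply: eq_integral => x _; rewrite diracE indicE; congr ((nat_of_bool _)%:R%:E).
by apply/idP/idP => /set_mem H; apply/mem_set; exact/CA.
Qed.

(** The first step is confined to a section of [E], of measure at most [y], and the remaining path
    contributes at most [y ^+ n] uniformly in its start. *)
Lemma power_measure_path (E : set (T * T)) (y : R) n (p : T) : measurable E ->
  (0 <= y)%R -> (forall p, mu (xsection E p) <= y%:E) ->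
  power_measure mu [set t : n.-tuple T | path (fun p q => `[< E (p, q) >]) p t]
    <= (y ^+ n)%:E.
Proof.
move=> mE y0 muE; elim: n p => [|n IH] p.
  by rewrite /= diracE expr0 lee_fin; case: (_ \in _).
have mEp := measurable_xsection p mE.
apply: (@le_trans _ _ (\int[mu]_x ((y ^+ n)%:E * (\1_(xsection E p) x)%:E))).
  apply: ge0_le_integralT => x; first exact: power_measure_ge0.
  rewrite indicE; case: (boolP (x \in xsection E p)); rewrite mem_xsection => /= xE.
    rewrite mule1 (le_trans _ (IH x))//.
    rewrite le_eqVlt; apply/orP; left; apply/eqP; congr (power_measure mu _).
    apply/seteqP; split=> t /=; first by case/andP.
    by move=> ->; rewrite andbT; apply/asboolP/set_mem.
  rewrite mule0 -(power_measure0 n); rewrite le_eqVlt; apply/orP; left; apply/eqP.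
  congr (power_measure mu _); apply/seteqP; split=> t //= /andP[/asboolP H _].
  by case/negP: xE; exact/mem_set.
rewrite ge0_integralZl//; first last.
- by rewrite lee_fin exprn_ge0.
- exact: measurableT_comp.
rewrite integral_indic// setIT exprSr EFinM lee_wpmul2l// lee_fin exprn_ge0//.
Qed.

End power_measures.

(** * Almost sure consequences of the moment bound *)

Section almost_sure.
Context (R : realType) d (W : measurableType d) (P : probability W R)
  (Psi : {mfun W >-> config_space R}) (c : R) (c_gt0 : 0 < c)
  (mu : {measure set (mpoint R) -> \bar R})
  (moment_bound : forall n : nat, (0 < n)%N ->
    forall C : set (n.-tuple (mpoint R)), measurable C ->
      (factorial_moment P Psi C <= (c ^+ n)%:E * power_measure mu C)%E).

Lemma tuple_event_null n (C : set (n.+1.-tuple (mpoint R))) : measurable C ->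
  power_measure mu C = 0%E ->
  {ae P, forall w, ~ exists t, distinct_tuples (Psi w) t /\ C t}.
Proof.
move=> mC C0; exists (tuple_event R d W Psi n.+1 C); split.
- exact: measurable_tuple_event.
- apply/eqP; rewrite -measure_le0 (le_trans (tuple_event_le _ _ _ P Psi _ _ mC))//.
  by rewrite (le_trans (moment_bound _ _ _ mC))// C0 mule0.
- by move=> w /= /contrapT.
Qed.

Definition rooted_paths (B : set (mpoint R)) (E : set (mpoint R * mpoint R)) n :
    set (n.+1.-tuple (mpoint R)) :=
  [set t | B (thead t) /\ path (fun p q => `[< E (p, q) >]) (thead t) (behead t)].

Lemma measurable_rooted_paths B E n : measurable B -> measurable E ->
  measurable (rooted_paths B E n).
Proof.
move=> mB mE.
have mroot : measurable [set t : n.+1.-tuple (mpoint R) | B (thead t)].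
  by have := @measurable_tnth _ (mpoint R) n.+1 ord0 measurableT _ mB; rewrite setTI.
pose S := \bigcap_(i in [set: 'I_n]) [set t : n.+1.-tuple (mpoint R) |
  E (tnth t (widen_ord (leqnSn n) i), tnth t (lift ord0 i))].
have mS : measurable S.
  by apply: fin_bigcap_measurable => // i _; exact: measurable_tnth2.
congr measurable: (measurableI _ _ mroot mS); congr setI.
apply/seteqP; split=> t; case/tupleP: t => p t; rewrite theadE /=.
  move=> H; apply/(pathP p) => i; rewrite size_tuple => ltin; apply/asboolP.
  by have := H (Ordinal ltin) I; rewrite /= tnthS !(tnth_nth p) /=.
move=> /(pathP p) H i _ /=.
have /asboolP := H i ltac:(by rewrite size_tuple).
by rewrite tnthS !(tnth_nth p) /=.
Qed.

(** The event is contained in every [A n], and the probabilities of the [A n] decay geometrically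
    because [c * y < 1]. *)
Lemma no_long_paths (B : set (mpoint R)) (E : set (mpoint R * mpoint R)) (y : R) :
  measurable B -> (mu B < +oo)%E -> measurable E -> 0 <= y -> c * y < 1 ->
  (forall p, mu (xsection E p) <= y%:E)%E ->
  {ae P, forall w, ~ forall n, exists t, distinct_tuples (Psi w) t /\ rooted_paths B E n t}.
Proof.
move=> mB Bfin mE y0 cy muE.
pose A n := tuple_event R d W Psi n.+1 (rooted_paths B E n).
have mA n : measurable (A n).
  by apply: measurable_tuple_event; exact: measurable_rooted_paths.
have muB0 : (0 <= fine (mu B)) by rewrite fine_ge0.
(* The [n + 1] points give [c ^+ n.+1], the root gives [mu B], and each step gives a factor [y]. *)
have PA n : (P (A n) <= (c * fine (mu B) * (c * y) ^+ n)%:E)%E.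
  apply: le_trans (tuple_event_le _ _ _ P Psi _ _ (measurable_rooted_paths _ _ n mB mE)) _.
  apply: le_trans (moment_bound _ _ _ (measurable_rooted_paths _ _ n mB mE)) _ => //.
  have -> : (c * fine (mu B) * (c * y) ^+ n)%:E = ((c ^+ n.+1)%:E * ((y ^+ n)%:E * mu B))%E.
    by rewrite -[mu B]fineK ?ge0_fin_numE// -!EFinM exprMn exprS; congr EFin; ring.
  apply: lee_wpmul2l; first by rewrite lee_fin exprn_ge0// ltW.
  apply: (@le_trans _ _ (\int[mu]_x ((y ^+ n)%:E * (\1_B x)%:E))%E).
    apply: ge0_le_integralT => x; first exact: power_measure_ge0.
    rewrite indicE; case: (boolP (x \in B)) => /= xB.
      rewrite mule1; apply: le_trans (power_measure_path _ _ _ _ _ _ n x mE y0 muE).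
      rewrite le_eqVlt; apply/orP; left; apply/eqP; congr (power_measure mu _).
      apply/seteqP; split=> t; rewrite /rooted_paths /= theadE /=; first by case.
      by split => //; exact: set_mem.
    rewrite mule0 -(power_measure0 _ _ _ mu n) le_eqVlt; apply/orP; left; apply/eqP.
    congr (power_measure mu _); apply/seteqP; split=> t //.
    rewrite /rooted_paths /= theadE => -[Bx _].
    by case/negP: xB; exact/mem_set.
  rewrite ge0_integralZl//; first last.
  - by rewrite lee_fin exprn_ge0.
  - exact: measurableT_comp.
  by rewrite integral_indic// setIT.
exists (\bigcap_n A n); split.
- exact: bigcapT_measurable.
- apply/eqP; rewrite -measure_le0; apply/lee_addgt0Pr => e e0; rewrite add0e.
  have cy_norm : `|c * y| < 1 by rewrite ger0_norm// mulr_ge0// ltW.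
  have /cvgr0Pnorm_lt/(_ e e0)[n _ /(_ n (leqnn n))/= ne] :=
    cvg_geometric (c * fine (mu B)) cy_norm.
  apply: (@le_trans _ _ (P (A n))).
    by apply: le_measure; rewrite ?inE//; [exact: bigcapT_measurable|exact: bigcap_inf].
  rewrite (le_trans (PA n))// lee_fin ltW//; apply: le_lt_trans ne.
  exact: ler_norm.
- by move=> w /= /contrapT H n _; exact: H.
Qed.

End almost_sure.

(** * Integrating over locations for a fixed mark *)

Section product_measure_bound.
Context (R : realType) d1 d2 (T1 : measurableType d1) (T2 : measurableType d2)
  (m : {measure set T1 -> \bar R}) (sigma_finite_m : sigma_finite setT m)
  (Q : probability T2 R).

(** The measure [m] under a name to which sigma-finiteness can be attached as a structure. *)
Let ms : set T1 -> \bar R := m.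
HB.instance Definition _ := Measure.on ms.
HB.instance Definition _ := Measure_isSigmaFinite.Build _ _ _ ms sigma_finite_m.

(** By uniqueness of the product measure the marks may be integrated last, and a uniform bound on
    the sections survives averaging over the probability [Q]. *)
Lemma product_measure_le (S : set (T1 * T2)) (y : \bar R) : measurable S ->
  (forall t, (m (ysection S t) <= y)%E) -> ((m \x Q) S <= y)%E.
Proof.
move=> mS HS.
have -> : (m \x Q)%E S = (ms \x^ Q)%E S.
  apply: (product_measure_unique (m1 := ms)) => // A B mA mB.
  exact: (@product_measure2E _ _ _ _ _ ms Q).
apply: (@le_trans _ _ (\int[Q]_x (cst y x))%E).
  by apply: ge0_le_integralT => x /=; [exact: measure_ge0|exact: HS].
rewrite integral_cst// [X in (_ * X)%E](_ : _ = 1%E) ?mule1//.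
exact: probability_setT.
Qed.

End product_measure_bound.

(** * Areas of lines and strips in the plane *)

Section planar_volumes.
Context (R : realType).
Local Open Scope ereal_scope.
Local Notation leb := (@lebesgue_measure R).
Local Notation leb2 := (leb \x leb)%E.
Local Notation plane_set := (set (measurableTypeR R * measurableTypeR R)).

Lemma lebesgue_itvcc (u v : R) : (u <= v)%R ->
  leb (`[u, v]%classic : set R) = (v - u)%:E.
Proof.
move=> uv; rewrite lebesgue_measure_itv /= lte_fin; case: ltP => // vu.
by rewrite (_ : u = v) ?subrr//; apply: le_anti; rewrite uv.
Qed.

Lemma lebesgue_strip (A : set (measurableTypeR R)) (a b lo hi : R) : measurable A ->
  (a != 0)%R -> (lo <= hi)%R ->
  (forall x, A x -> (lo <= a * x + b <= hi)%R) ->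
  leb A <= ((hi - lo) / `|a|)%:E.
Proof.
move=> mA a0 lohi HA.
have na : (0 < `|a|)%R by rewrite normr_gt0.
(* Midpoint and half-length of the interval of all [x] with [lo <= a * x + b <= hi]. *)
pose m := (((lo + hi) / 2 - b) / a)%R; pose r := ((hi - lo) / 2 / `|a|)%R.
have sub : A `<=` `[(m - r)%R, (m + r)%R]%classic.
  move=> x /HA /andP[h1 h2]; rewrite /= in_itv /= -ler_distl.
  rewrite /r ler_pdivlMr// -normrM mulrBl /m divfK//.
  by rewrite ler_norml; apply/andP; split; lra.
apply: le_trans (le_measure leb _ _ sub) _; rewrite ?inE//.
have r0 : (0 <= r)%R by rewrite /r !divr_ge0// ?subr_ge0// ltW.
rewrite [leLHS]lebesgue_itvcc; last by lra.
rewrite lee_fin /r.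
by rewrite (_ : (_ - _ = (hi - lo) / `|a|)%R)//; field; rewrite gt_eqF.
Qed.

(** The sign of [a * x + b] splits the set into two strips, the second one for the coefficients
    [- a] and [- b]. *)
Lemma lebesgue_abs_strip (A : set (measurableTypeR R)) (a b lo hi : R) : measurable A ->
  (a != 0)%R -> (lo <= hi)%R ->
  (forall x, A x -> (lo <= `|a * x + b| <= hi)%R) ->
  leb A <= ((hi - lo) / `|a| + (hi - lo) / `|a|)%:E.
Proof.
move=> mA a0 lohi HA.
have mf : measurable_fun setT (fun x : measurableTypeR R => a * x + b)%R.
  by apply: measurable_funD => //; exact: measurable_funM.
have mpos : measurable [set x : measurableTypeR R | 0 <= a * x + b]%R.
  have := mf measurableT _ (measurable_itv `[0%R, +oo[); rewrite setTI.
  by congr measurable; apply/seteqP; split => x /=; rewrite in_itv /= andbT.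
have -> : A = (A `&` [set x | 0 <= a * x + b]%R) `|` (A `&` ~` [set x | 0 <= a * x + b]%R).
  by rewrite -setIUr setUv setIT.
have mA1 := measurableI _ _ mA mpos.
have mA2 := measurableI _ _ mA (measurableC mpos).
rewrite EFinD (le_trans (measureU2 leb mA1 mA2))// leeD//.
  apply: (lebesgue_strip _ _ b) => // x [/HA + /= h]; by rewrite ger0_norm.
rewrite -(normrN a); apply: (lebesgue_strip _ _ (- b)%R) => //.
  by rewrite oppr_eq0.
move=> x [/HA + /= /negP]; rewrite -ltNge => + h; rewrite ltr0_norm//.
by rewrite mulNr -opprD.
Qed.

Lemma leb2E (S : plane_set) : measurable S -> leb2 S = (leb \x^ leb) S.
Proof.
move=> mS; apply: product_measure_unique => // A B mA mB.
exact: (product_measure2E leb leb mA mB).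
Qed.

Lemma leb2_sigma_finite : sigma_finite setT leb2.
Proof.
pose I (n : nat) : set (measurableTypeR R) := `[(- n%:R)%R, n%:R]%classic.
have mI n : measurable (I n) by exact: measurable_itv.
have Ifin n : leb (I n) < +oo.
  by rewrite [ltLHS]lebesgue_itvcc ?ltry// lerNl (le_trans _ (ler0n _ _))// oppr_le0.
exists (fun n => I n `*` I n).
  apply/seteqP; split => // z _.
  have [n hn] : exists n : nat, (`|z.1| + `|z.2| <= n%:R)%R.
    exists `|Num.ceil (`|z.1| + `|z.2|)%R|%N.
    by rewrite natr_absz (le_trans (ceil_ge _))// ler_int ler_norm.
  exists n => //; split; rewrite /I /= in_itv /= -ler_norml (le_trans _ hn)//.
    by rewrite lerDl.
  by rewrite lerDr.
move=> n; split; first exact: measurableX.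
rewrite product_measure1E//; apply: lte_mul_pinfty.
- exact: measure_ge0.
- by rewrite ge0_fin_numE ?measure_ge0//; exact: Ifin.
- exact: Ifin.
Qed.

(** Slicing along an axis with nonzero coefficient leaves strips of width 0. *)
Lemma leb2_line (S : plane_set) (a b k : R) : measurable S ->
  (a != 0)%R || (b != 0)%R ->
  (forall z, S z -> (a * z.1 + b * z.2 + k = 0)%R) -> leb2 S = 0.
Proof.
move=> mS ab HS; have [b0|b0] := boolP (b != 0)%R.
  apply: integral0_eq => x _; apply/eqP; rewrite -measure_le0.
  have := lebesgue_strip (xsection S x) b (a * x + k)%R 0%R 0%R
    (measurable_xsection x mS) b0 (lexx _).
  rewrite subrr mul0r; apply => y; rewrite /xsection /= inE => /HS /= e.
  by rewrite (_ : (_ + _ = 0)%R) ?lexx// -e; ring.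
move: ab; rewrite (negbTE b0) orbF => a0.
rewrite leb2E//; apply: integral0_eq => y _; apply/eqP; rewrite -measure_le0.
have := lebesgue_strip (ysection S y) a (b * y + k)%R 0%R 0%R
  (measurable_ysection y mS) a0 (lexx _).
rewrite subrr mul0r; apply => x; rewrite /ysection /= inE => /HS /= e.
by rewrite (_ : (_ + _ = 0)%R) ?lexx// -e; ring.
Qed.

Lemma integral_centered (f : R -> \bar R) (x0 l y : R) : (0 <= l)%R -> (0 <= y)%R ->
  (forall x, 0 <= f x) -> (forall x, f x <= y%:E) ->
  (forall x, (l < `|x - x0|)%R -> f x = 0) ->
  \int[leb]_x f x <= (y * (l + l))%:E.
Proof.
move=> l0 y0 f0 fy fz.
pose I : set (measurableTypeR R) := `[(x0 - l)%R, (x0 + l)%R]%classic.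
have mI : measurable I by exact: measurable_itv.
apply: (@le_trans _ _ (\int[leb]_x (y%:E * (\1_I x)%:E))).
  apply: ge0_le_integralT => // x; rewrite indicE; case: (boolP (x \in I)) => xI.
    by rewrite mule1.
  rewrite fz ?mule0// ltNge; apply/negP => h; case/negP: xI.
  by rewrite inE /I /= in_itv /= -ler_distl.
rewrite ge0_integralZl//; last exact: measurableT_comp.
rewrite integral_indic// setIT EFinM lee_wpmul2l//.
rewrite [leLHS]lebesgue_itvcc; last by lra.
by rewrite lee_fin; lra.
Qed.

(** One coordinate of the unit normal [(a, b)] is at least 1/2 in absolute value. Slices along that
    axis have length at most [4 * (hi - lo)], and the other coordinate ranges over an interval of
    length [l + l]. *)
Lemma leb2_strip (S : plane_set) (a b k x0 y0 l lo hi : R) : measurable S ->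
  (a ^+ 2 + b ^+ 2 = 1)%R -> (0 <= l)%R -> (lo <= hi)%R ->
  (forall z, S z -> [/\ `|z.1 - x0| <= l, `|z.2 - y0| <= l &
     lo <= `|a * z.1 + b * z.2 + k| <= hi])%R ->
  leb2 S <= (8 * l * (hi - lo))%:E.
Proof.
move=> mS ab l0 lohi HS.
have bnd (e : R) : (1 / 2 <= `|e|)%R ->
    ((hi - lo) / `|e| + (hi - lo) / `|e| <= 4 * (hi - lo))%R.
  move=> he; have e0 : (0 < `|e|)%R by lra.
  have : ((hi - lo) / `|e| <= 2 * (hi - lo))%R.
    by rewrite ler_pdivrMr//; nra.
  by lra.
have -> : (8 * l * (hi - lo) = 4 * (hi - lo) * (l + l))%R by ring.
have y4 : (0 <= 4 * (hi - lo))%R by lra.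
have [b2|b2] := leP (1 / 2)%R `|b|%R.
  have b0 : (b != 0)%R by rewrite -normr_gt0; lra.
  apply: (integral_centered _ x0) => // x.
    apply: (@le_trans _ _ ((hi - lo) / `|b| + (hi - lo) / `|b|)%:E);
      last by rewrite lee_fin bnd.
    apply: (lebesgue_abs_strip _ _ (a * x + k)%R) => //; first exact: measurable_xsection.
    move=> y; rewrite /xsection /= inE => /HS[_ _] /=.
    by rewrite (_ : (b * y + (a * x + k) = a * x + b * y + k)%R)//; ring.
  move=> hx /=; rewrite (_ : xsection S x = set0) ?measure0//.
  apply/seteqP; split => // y; rewrite /xsection /= inE => /HS[/= h _ _].
  by move: hx; rewrite ltNge h.
(* Two coordinates below 1/2 would give [a ^+ 2 + b ^+ 2 < 1]. *)
have a2 : (1 / 2 <= `|a|)%R.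
  rewrite leNgt; apply/negP => a2.
  move: ab; rewrite -(real_normK (num_real a)) -(real_normK (num_real b)).
  have := normr_ge0 a; have := normr_ge0 b; nra.
have a0 : (a != 0)%R by rewrite -normr_gt0; lra.
rewrite leb2E//; apply: (integral_centered _ y0) => // y.
  apply: (@le_trans _ _ ((hi - lo) / `|a| + (hi - lo) / `|a|)%:E);
    last by rewrite lee_fin bnd.
  apply: (lebesgue_abs_strip _ _ (b * y + k)%R) => //; first exact: measurable_ysection.
  move=> x; rewrite /ysection /= inE => /HS[_ _] /=.
  by rewrite addrA.
move=> hy /=; rewrite (_ : ysection S y = set0) ?measure0//.
apply/seteqP; split => // x; rewrite /ysection /= inE => /HS[/= _ h _].
by move: hy; rewrite ltNge h.
Qed.

End planar_volumes.

(** * Measurability and size of the edge relation *)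

Section null_events.
Context (R : realType).

Lemma measurable_le_fun d (T : measurableType d) (f g : T -> R) :
  measurable_fun setT f -> measurable_fun setT g ->
  measurable [set x | f x <= g x].
Proof.
move=> mf mg.
have := measurable_funB mg mf => /(_ measurableT _ (measurable_itv `[0, +oo[)).
rewrite setTI; congr measurable; apply/seteqP; split=> x /=;
  by rewrite in_itv /= andbT subr_ge0.
Qed.

Section measurable_coordinates.
Context d (T : measurableType d) (f g : T -> mpoint R).
Context (mf : measurable_fun setT f) (mg : measurable_fun setT g).

Lemma measurable_coordinates (h : T -> mpoint R) : measurable_fun setT h ->
  [/\ measurable_fun setT (fun x => (h x).1.1 : R),
      measurable_fun setT (fun x => (h x).1.2 : R) &
      measurable_fun setT (fun x => (h x).2 : R)].
Proof.
move=> mh; have mh1 := measurableT_comp measurable_fst mh.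
split; [exact: (measurableT_comp measurable_fst mh1)|
  exact: (measurableT_comp measurable_snd mh1)|exact: (measurableT_comp measurable_snd mh)].
Qed.

Lemma measurable_wedge (th : T -> R) : measurable_fun setT th ->
  measurable_fun setT (fun x => wedge R (f x) (g x) (th x)).
Proof.
move=> mth; have [f1 f2 _] := measurable_coordinates f mf.
have [g1 g2 _] := measurable_coordinates g mg.
have ms := measurableT_comp (continuous_measurable_fun (@continuous_sin R)) mth.
have mc := measurableT_comp (continuous_measurable_fun (@continuous_cos R)) mth.
apply: measurable_funB; apply: measurable_funM => //; exact: measurable_funB.
Qed.

Lemma measurable_sin_sub : measurable_fun setT (fun x => sin ((g x).2 - (f x).2) : R).
Proof.
have [_ _ f3] := measurable_coordinates f mf.
have [_ _ g3] := measurable_coordinates g mg.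
exact: (measurableT_comp (continuous_measurable_fun (@continuous_sin R))
  (measurable_funB g3 f3)).
Qed.

End measurable_coordinates.

Lemma measurable_edge T h m : measurable (edge R T h m).
Proof.
have mf : measurable_fun setT (fst : mpoint R * mpoint R -> mpoint R) by [].
have mg : measurable_fun setT (snd : mpoint R * mpoint R -> mpoint R) by [].
have [f1 f2 f3] := measurable_coordinates _ _ _ mf.
have [g1 g2 g3] := measurable_coordinates _ _ _ mg.
have ms := measurableT_comp (@normr_measurable R setT) (measurable_sin_sub _ _ _ _ mf mg).
have mw := measurableT_comp (@normr_measurable R setT) (measurable_wedge _ _ _ _ mf mg _ f3).
have m1 := measurable_abs_le R _ _ _ (T + T) (measurable_funB g1 f1).
have m2 := measurable_abs_le R _ _ _ (T + T) (measurable_funB g2 f2).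
have mk (k : R) : measurable_fun setT
    (fun x : mpoint R * mpoint R => k * `|sin (x.2.2 - x.1.2)|).
  exact: measurable_funM.
have m3 := measurable_le_fun _ _ _ _ (mk ((m%:R - 1) * h)) mw.
have m4 := measurable_le_fun _ _ _ _ mw (mk (m%:R * h)).
congr measurable: (measurableI _ _ (measurableI _ _ m1 m2) (measurableI _ _ m3 m4)).
apply/seteqP; split=> x /=.
  by case=> -[h1 h2] [h3 h4]; split => //; apply/andP.
by case=> h1 h2 /andP[h3 h4].
Qed.

Context (Q : probability (measurableTypeR R) R).
Local Notation leb2 := (@lebesgue_measure R \x @lebesgue_measure R)%E.

(** For a fixed mark the second location lies in two strips along the line of [p], within a box of
    half-width [T + T]. Their width [h * |sin (th - p.2)|] does not depend on [m]. *)
Lemma edge_section_le (T h : R) m p : 0 <= T -> 0 <= h ->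
  (location_mark_measure Q (xsection (edge R T h m) p) <= (8 * (T + T) * h)%:E)%E.
Proof.
move=> T0 h0; have mS := measurable_xsection p (measurable_edge T h m).
rewrite /location_mark_measure; apply: product_measure_le => [|//|th].
  exact: leb2_sigma_finite.
apply: (@le_trans _ _ (8 * (T + T) * (m%:R * h * `|sin (th - p.2)| -
    (m%:R - 1) * h * `|sin (th - p.2)|))%:E).
  apply: (leb2_strip _ _ (sin p.2) (- cos p.2)
    (- (p.1.1 * sin p.2 - p.1.2 * cos p.2)) p.1.1 p.1.2).
  - exact: measurable_ysection.
  - by rewrite sqrrN addrC cos2Dsin2.
  - exact: addr_ge0.
  - have := mulr_ge0 h0 (normr_ge0 (sin (th - p.2))); lra.
  - move=> z; rewrite /ysection /= inE /= /xsection /= inE => -[/= h1 h2 h3].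
    split => //; move: h3; rewrite /wedge /=.
    by rewrite (_ : sin p.2 * z.1 + - cos p.2 * z.2 + - (p.1.1 * sin p.2 - p.1.2 * cos p.2)
      = (z.1 - p.1.1) * sin p.2 - (z.2 - p.1.2) * cos p.2)//; ring.
rewrite lee_fin; apply: ler_wpM2l; first by rewrite mulr_ge0// addr_ge0.
rewrite (_ : _ - _ = h * `|sin (th - p.2)|); last by ring.
by rewrite ler_piMr// sin_max.
Qed.

Lemma centered_box_lty (l : R) : 0 <= l ->
  (location_mark_measure Q (centered_box R l) < +oo)%E.
Proof.
move=> l0; apply: (@le_lt_trans _ _ (8 * l * (l - 0))%:E); last exact: ltry.
have mB := measurable_centered_box R l.
rewrite /location_mark_measure; apply: product_measure_le => [|//|th].
  exact: leb2_sigma_finite.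
(* The box is seen as the strip [0 <= |z.1| <= l]; any finite bound will do. *)
apply: (leb2_strip _ _ 1 0 0 0 0) => //.
- exact: measurable_ysection.
- by rewrite expr1n expr0n addr0.
- move=> z; rewrite /ysection /= inE => -[/= h1 h2].
  by rewrite !subr0 mul1r mul0r !addr0 normr_ge0.
Qed.

End null_events.

(** * Ties confine a location to a line *)

Section ties.
Context (R : realType) (Q : probability (measurableTypeR R) R).
Local Notation mu := (location_mark_measure Q).
Local Notation leb2 := (@lebesgue_measure R \x @lebesgue_measure R)%E.

(** For each mark of [q] the section lies on a line; it is empty at marks where both coefficients
    vanish. *)
Lemma line_sections_null (S : set (mpoint R)) (a b k : R -> R) : measurable S ->
  (forall q, S q -> a q.2 * q.1.1 + b q.2 * q.1.2 + k q.2 = 0 /\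
     ((a q.2 != 0) || (b q.2 != 0))) ->
  mu S = 0%E.
Proof.
move=> mS HS; apply/eqP; rewrite -measure_le0.
rewrite /location_mark_measure; apply: product_measure_le => [|//|th].
  exact: leb2_sigma_finite.
have [ab|nab] := boolP ((a th != 0) || (b th != 0)).
  rewrite le_eqVlt; apply/orP; left; apply/eqP.
  apply: (leb2_line _ _ (a th) (b th) (k th)) => //; first exact: measurable_ysection.
  by move=> z; rewrite /ysection /= inE => /HS[].
rewrite (_ : ysection S th = set0) ?measure0//.
apply/seteqP; split => // z; rewrite /ysection /= inE => /HS[_] /=.
by rewrite (negbTE nab).
Qed.

Lemma sin_cos_neq0 (th : R) : (sin th != 0) || (- cos th != 0).
Proof.
rewrite oppr_eq0 -negb_and; apply/negP => /andP[/eqP s0 /eqP c0].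
by have /eqP := cos2Dsin2 th; rewrite s0 c0 expr0n /= addr0 eq_sym oner_eq0.
Qed.

Definition on_line_pairs : set (mpoint R * mpoint R) :=
  [set x | wedge R x.1 x.2 x.1.2 = 0].

(** For [e = 1] or [e = -1] this is [cross_dist p q = cross_dist q p] with the common denominator
    cleared and the absolute values resolved by the sign [e]. *)
Definition tie_pairs (e : R) : set (mpoint R * mpoint R) :=
  [set x | sin (x.2.2 - x.1.2) <> 0 /\
    wedge R x.1 x.2 x.2.2 = e * wedge R x.1 x.2 x.1.2].

(* The point q comes last because it is its location that is integrated out. *)
Definition tie_triples (i : bool) (e : R) : set ((mpoint R * mpoint R) * mpoint R) :=
  [set x | let: (p, r, q) := x in sin (r.2 - p.2) <> 0 /\
    wedge R p q q.2 * sin (r.2 - p.2) =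
      e * wedge R p r (if i then r.2 else p.2) * sin (q.2 - p.2)].

Let mcst d (T : measurableType d) (k : R) : measurable_fun setT (fun _ : T => k).
Proof. exact: measurable_cst. Qed.

Lemma measurable_on_line_pairs : measurable on_line_pairs.
Proof.
have mf : measurable_fun setT (fst : mpoint R * mpoint R -> mpoint R) by [].
have mg : measurable_fun setT (snd : mpoint R * mpoint R -> mpoint R) by [].
have [_ _ f3] := measurable_coordinates _ _ _ _ mf.
exact: (measurable_eq_fun _ _ _ _ _ (measurable_wedge _ _ _ _ _ mf mg _ f3) (mcst _ _ 0)).
Qed.

Lemma measurable_tie_pairs e : measurable (tie_pairs e).
Proof.
have mf : measurable_fun setT (fst : mpoint R * mpoint R -> mpoint R) by [].
have mg : measurable_fun setT (snd : mpoint R * mpoint R -> mpoint R) by [].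
have [_ _ f3] := measurable_coordinates _ _ _ _ mf.
have [_ _ g3] := measurable_coordinates _ _ _ _ mg.
have ms := measurable_eq_fun _ _ _ _ _ (measurable_sin_sub _ _ _ _ _ mf mg) (mcst _ _ 0).
apply: (measurableI _ _ (measurableC ms)).
apply: (measurable_eq_fun _ _ _ _ _ (measurable_wedge _ _ _ _ _ mf mg _ g3)).
exact: measurable_funM (mcst _ _ e) (measurable_wedge _ _ _ _ _ mf mg _ f3).
Qed.

Lemma measurable_tie_triples i e : measurable (tie_triples i e).
Proof.
pose T : measurableType _ := ((mpoint R * mpoint R) * mpoint R)%type.
have mf : measurable_fun setT (fun x : T => x.1.1).
  exact: (measurableT_comp measurable_fst measurable_fst).
have mg : measurable_fun setT (fun x : T => x.1.2).
  exact: (measurableT_comp measurable_snd measurable_fst).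
have mh : measurable_fun setT (fun x : T => x.2) by exact: measurable_snd.
have [_ _ f3] := measurable_coordinates _ _ _ _ mf.
have [_ _ g3] := measurable_coordinates _ _ _ _ mg.
have [_ _ h3] := measurable_coordinates _ _ _ _ mh.
have mi : measurable_fun setT (fun x : T => if i then x.1.2.2 else x.1.1.2 : R).
  by case: (i).
have ms := measurable_sin_sub _ _ _ _ _ mf mg.
have m1 := measurableC (measurable_eq_fun _ _ _ _ _ ms (mcst _ _ 0)).
have m2 := measurable_eq_fun _ _ _ _ _
  (measurable_funM (measurable_wedge _ _ _ _ _ mf mh _ h3) ms)
  (measurable_funM (measurable_funM (mcst _ _ e) (measurable_wedge _ _ _ _ _ mf mg _ mi))
     (measurable_sin_sub _ _ _ _ _ mf mh)).
by congr measurable: (measurableI _ _ m1 m2); apply/seteqP; split=> -[[p r] q].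
Qed.

Lemma on_line_pairs_null p : mu (xsection on_line_pairs p) = 0%E.
Proof.
apply: (line_sections_null _ (fun=> sin p.2) (fun=> - cos p.2)
  (fun=> p.1.2 * cos p.2 - p.1.1 * sin p.2)).
  exact: measurable_xsection measurable_on_line_pairs.
move=> q; rewrite /xsection /= inE => H; split; last exact: sin_cos_neq0.
by rewrite -[RHS]H /wedge /=; ring.
Qed.

Lemma tie_pairs_null e p : mu (xsection (tie_pairs e) p) = 0%E.
Proof.
apply: (line_sections_null _ (fun th => sin th - e * sin p.2)
  (fun th => - (cos th - e * cos p.2))
  (fun th => p.1.2 * (cos th - e * cos p.2) - p.1.1 * (sin th - e * sin p.2))).
  exact: measurable_xsection (measurable_tie_pairs e).
move=> q; rewrite /xsection /= inE => -[/= s0 H]; split.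
  by move: H; rewrite /wedge => H; lra.
(* If both coefficients vanished, the direction of [q] would be [e] times that of [p], and the sine
   of the angle between them would be 0. *)
rewrite oppr_eq0 -negb_and; apply/negP => /andP[/eqP a0 /eqP b0]; apply: s0.
rewrite sinB; move/subr0_eq: a0 => ->; move/subr0_eq: b0 => ->; ring.
Qed.

(** With [p] and [r] fixed, the right-hand side of the tie depends on [q] only through its mark, so
    the equation is linear in the location of [q] with normal [s] times a unit vector. *)
Lemma tie_triples_null i e p r : mu (xsection (tie_triples i e) (p, r)) = 0%E.
Proof.
pose s := sin (r.2 - p.2).
pose v := e * wedge R p r (if i then r.2 else p.2).
apply: (line_sections_null _ (fun th => s * sin th) (fun th => - (s * cos th))
  (fun th => s * (p.1.2 * cos th - p.1.1 * sin th) - v * sin (th - p.2))).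
  exact: measurable_xsection (measurable_tie_triples i e).
move=> q; rewrite /xsection /= inE => -[/= /eqP s0 H]; split.
  by move: H; rewrite -/s -/v /wedge => H; lra.
by rewrite -mulrN !mulf_eq0 !(negbTE s0) /= sin_cos_neq0.
Qed.

Lemma tie_free_of_no_ties p q : p.2 \in `[0, pi[ -> q.2 \in `[0, pi[ ->
  ~ on_line_pairs (p, q) -> (forall i : bool, ~ tie_pairs ((-1) ^+ i) (p, q)) ->
  tie_free R p q.
Proof.
move=> hp hq nol nt; rewrite /tie_free.
have [epq|npq] := eqVneq p.2 q.2.
  rewrite /cross_dist epq eqxx; case: ifPn => //; rewrite inE => -[t _ e].
  case: nol; rewrite /on_line_pairs /= /wedge -e /on_line /=; ring.
have s0 := sin_sub_neq0 _ _ _ hp hq npq.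
rewrite !cross_distE//; last by rewrite eq_sym.
rewrite (wedgeC _ p q) normrN -[p.2 - q.2]opprB sinN normrN => -[] e; exfalso.
have sV : `|sin (q.2 - p.2)|^-1 != 0 by rewrite invr_eq0 normr_eq0.
have := mulIf sV e.
move/eqP; rewrite eqr_norm2 => /orP[|] /eqP h; [case: (nt false)|case: (nt true)].
  by split; [exact/eqP|rewrite expr0 mul1r].
by split; [exact/eqP|rewrite expr1 mulN1r].
Qed.

(** In [tie_triples] the value [i = true] encodes [cross_dist p q = cross_dist p r] and [i = false]
    encodes [cross_dist p q = cross_dist r p]; the sign resolves the absolute values. Parallel marks
    are excluded because they give infinite distances. *)
Lemma no_three_point_tie p q r :
  p.2 \in `[0, pi[ -> q.2 \in `[0, pi[ -> r.2 \in `[0, pi[ ->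
  tie_free R p q -> tie_free R p r ->
  (forall i j : bool, ~ tie_triples i ((-1) ^+ j) ((p, r), q)) ->
  (cross_dist p q < +oo)%E ->
  cross_dist p q <> cross_dist p r /\ cross_dist p q <> cross_dist r p.
Proof.
move=> hp hq hr tq tr nt fin.
have nonpar x : tie_free R p x -> (cross_dist p x < +oo)%E -> p.2 != x.2.
  move=> tx finx; apply/eqP => e; move: finx.
  by rewrite tx ?ltxx//; exact: parallel_cross_distC.
have npq := nonpar _ tq fin.
have s0 := sin_sub_neq0 _ _ _ hp hq npq.
have key (i : bool) : p.2 != r.2 ->
    `|wedge R p q q.2| / `|sin (q.2 - p.2)| =
    `|wedge R p r (if i then r.2 else p.2)| / `|sin (r.2 - p.2)| -> False.
  move=> npr; have s1 := sin_sub_neq0 _ _ _ hp hr npr.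
  move=> /eqP; rewrite eqr_div ?normr_eq0// -!normrM eqr_norm2.
  case/orP => /eqP h; [apply: (nt i false)|apply: (nt i true)];
    by split; [exact/eqP|rewrite h ?expr0 ?expr1 ?mul1r ?mulN1r ?mulNr].
split=> e.
  have npr : p.2 != r.2 by apply: nonpar; rewrite -?e.
  by move: e; rewrite !cross_distE// => -[]; exact: (key true).
have [epr|npr] := eqVneq p.2 r.2.
  have e' : cross_dist p r = cross_dist r p by exact: parallel_cross_distC.
  by move: fin; rewrite e -e' (tr e') ltxx.
move: e; rewrite !cross_distE//; last by rewrite eq_sym.
rewrite [wedge R r p _]wedgeC normrN -[p.2 - r.2]opprB sinN normrN => -[].
exact: (key false).
Qed.

End ties.

(** * Almost sure general position and absence of infinite chains *)

Section assembly.
Context (R : realType) d (W : measurableType d) (P : probability W R)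
  (Psi : {mfun W >-> config_space R}) (c : R) (c_gt0 : 0 < c)
  (Q : probability (measurableTypeR R) R)
  (moment_bound : forall n : nat, (0 < n)%N ->
    forall C : set (n.-tuple (mpoint R)), measurable C ->
      (factorial_moment P Psi C <=
         (c ^+ n)%:E * power_measure (location_mark_measure Q) C)%E).
Local Notation mu := (location_mark_measure Q).

Lemma ae_forall_countable (T : countType) (A : T -> W -> Prop) :
  (forall i, {ae P, forall w, A i w}) -> {ae P, forall w, forall i, A i w}.
Proof.
move=> H; have : P.-negligible (\bigcup_n
    (if unpickle n is Some i then ~` [set w | A i w] else set0)).
  apply: negligible_bigcup => n; case: (unpickle n) => [i|]; first exact: H.
  exact: negligible_set0.
apply: negligibleS => w /= /existsNP[i Ai]; exists (pickle i) => //.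
by rewrite pickleK.
Qed.

Lemma pairs_null (E : set (mpoint R * mpoint R)) : measurable E ->
  (forall p, mu (xsection E p) = 0%E) ->
  {ae P, forall w, forall p q, points (Psi w) p -> points (Psi w) q ->
    p <> q -> ~ E (p, q)}.
Proof.
move=> mE E0.
pose C := [set t : 2.-tuple (mpoint R) | E (tnth t ord0, tnth t (lift ord0 ord0))].
have mC : measurable C by exact: measurable_tnth2.
have C0 : power_measure mu C = 0%E.
  apply: power_measureS_eq0 => p; rewrite -(E0 p).
  apply: power_measure1; first exact: measurable_xsection.
  by move=> q; rewrite /C /= /xsection /= inE tnthS.
have := tuple_event_null _ _ _ P Psi c mu moment_bound 1 C mC C0.
apply: filterS => w H p q Xp Xq pq Epq; apply: H.
exists [tuple p; q]; split; last by [].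
split; first by rewrite /= inE andbT; apply/eqP.
by move=> i; case: (unliftP ord0 i) => [j|] -> //; rewrite tnthS [j]ord1.
Qed.

Lemma triples_null (E : set ((mpoint R * mpoint R) * mpoint R)) : measurable E ->
  (forall p r, mu (xsection E (p, r)) = 0%E) ->
  {ae P, forall w, forall p q r, points (Psi w) p -> points (Psi w) q ->
    points (Psi w) r -> p <> q -> p <> r -> q <> r -> ~ E ((p, r), q)}.
Proof.
move=> mE E0.
pose f (t : 3.-tuple (mpoint R)) :=
  ((tnth t ord0, tnth t (lift ord0 ord0)), tnth t (lift ord0 (lift ord0 ord0))).
have mf : measurable_fun setT f.
  by apply: measurable_fun_pair; [apply: measurable_fun_pair|]; exact: measurable_tnth.
have mC : measurable (f @^-1` E) by rewrite -[_ @^-1` _]setTI; exact: mf.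
have C0 : power_measure mu (f @^-1` E) = 0%E.
  apply: power_measureS_eq0 => p; apply: power_measureS_eq0 => r; rewrite -(E0 p r).
  apply: power_measure1; first exact: measurable_xsection.
  by move=> q; rewrite /f /= /xsection /= inE !tnthS.
have := tuple_event_null _ _ _ P Psi c mu moment_bound 2 _ mC C0.
apply: filterS => w H p q r Xp Xq Xr pq pr qr Epq; apply: H.
(* The order of the tuple makes [q] the variable of the innermost integral. *)
exists [tuple p; r; q]; split; last by [].
split.
  by rewrite /= !inE !andbT negb_or; apply/andP; split; [apply/andP; split|];
    apply/eqP => // /esym.
move=> i; case: (unliftP ord0 i) => [j|] -> //; rewrite tnthS.
by case: (unliftP ord0 j) => [l|] -> //; rewrite tnthS [l]ord1.
Qed.

Lemma ae_general_position : {ae P, forall w, general_position R (Psi w)}.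
Proof.
have H1 := pairs_null _ (measurable_on_line_pairs R) (on_line_pairs_null R Q).
have H2 := ae_forall_countable bool _ (fun i =>
  pairs_null _ (measurable_tie_pairs R ((-1) ^+ i)) (tie_pairs_null R Q ((-1) ^+ i))).
have H3 := ae_forall_countable (bool * bool)%type _ (fun i =>
  triples_null _ (measurable_tie_triples R i.1 ((-1) ^+ i.2))
    (tie_triples_null R Q i.1 ((-1) ^+ i.2))).
apply: filterS3 H1 H2 H3 => w h1 h2 h3.
have marks p : points (Psi w) p -> (p.2 : R) \in `[0, pi[.
  by move/(config_marks (c := Psi w)).
have tf p q : points (Psi w) p -> points (Psi w) q -> p <> q -> tie_free R p q.
  move=> Xp Xq pq; apply: tie_free_of_no_ties; [exact: marks|exact: marks|exact: h1|].
  by move=> i; exact: h2.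
split => // p q r Xp Xq Xr pq pr qr fin.
apply: no_three_point_tie; try exact: marks; try exact: tf; last by [].
by move=> i j; exact: (h3 (i, j)).
Qed.

Lemma ae_no_descending_chain : {ae P, forall w, general_position R (Psi w) ->
  no_descending_chain R (Psi w)}.
Proof.
(* This makes [c] times the edge bound [8 * (T + T) * h] less than 1; the summand 1 gives the strict
   inequality and covers [T = 0]. *)
pose h (T : nat) : R := (8 * (T%:R + T%:R) * c + 1)^-1.
have h0 T : 0 < h T.
  by rewrite invr_gt0 ltr_wpDl// !mulr_ge0// ?addr_ge0// ltW.
(* Since [h] is a function of [T], the exceptional events are indexed by the countably many triples
   [(T, m, N)]. *)
have H (i : nat * nat * nat) :
    {ae P, forall w, ~ long_paths R (Psi w) i.1.1%:R (h i.1.1) i.1.2 i.2}.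
  case: i => [[T m] N] /=.
  have T0 : 0 <= T%:R :> R by [].
  have cy : c * (8 * (T%:R + T%:R) * h T) < 1.
    rewrite mulrA ltr_pdivrMr ?mul1r.
      by rewrite mulrC ltrDl.
    by rewrite ltr_wpDl// !mulr_ge0// ?addr_ge0// ltW.
  have y0 : 0 <= 8 * (T%:R + T%:R) * h T by rewrite !mulr_ge0// ?addr_ge0// ltW.
  have := no_long_paths _ _ _ P Psi c c_gt0 mu moment_bound (centered_box R N%:R)
    (edge R T%:R (h T) m) (8 * (T%:R + T%:R) * h T)
    (measurable_centered_box R N%:R) (centered_box_lty R Q N%:R (ler0n _ _))
    (measurable_edge R _ _ _) y0 cy (fun p => edge_section_le R Q _ _ m p T0 (ltW (h0 T))).
  apply: filterS => w H lp; apply: H => n; have [p [t [st ut Xt [p1 p2] pt]]] := lp n.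
  have st' : size (p :: t) == n.+1 by rewrite /= st.
  exists (Tuple st'); split.
    by split => // i; apply: Xt; exact: mem_tnth.
  by split.
have := ae_forall_countable _ _ H.
apply: filterS => w {}H gp; apply: contrapT.
move=> /(long_paths_of_chain _ _ gp)[T] /(_ (h T) (h0 T))[m [N]].
exact: (H (T, m, N)).
Qed.

End assembly.

Theorem theorem5p1 (R : realType) (d : measure_display) (W : measurableType d)
    (P : probability W R) (Psi : {mfun W >-> config_space R})
    (Psi_simple : {ae P, forall w, simple_ground (Psi w)})
    (c : R) (c_gt0 : 0 < c)
    (Q : probability (measurableTypeR R) R) (Q_marks : Q `[0, pi[%classic = 1%E)
    (moment_bound : forall n : nat, (0 < n)%N ->
      forall C : set (n.-tuple (mpoint R)), measurable C ->
        (factorial_moment P Psi C <=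
           (c ^+ n)%:E * power_measure (location_mark_measure Q) C)%E) :
  forall k : growth_type,
    {ae P, forall w, exists_unique_gmhs_model k (Psi w)}.
Proof.
move=> k.
apply: filterS2 (ae_general_position _ _ _ _ _ _ _ moment_bound)
  (ae_no_descending_chain _ _ _ _ _ _ c_gt0 _ moment_bound).
by move=> w gp /(_ gp); exact: gmhs_exists_unique.
Qed.
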